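(* Let $T$ be a tree of order at least $6$. Then the following four statements are equivalent: (1) $T$ is in Class $3$, i.e. $\mathrm{sd}_{\gamma_t}(T)=3$; (2) $T\in\mathcal{T}$; (3) $T\in\mathcal{O}$; (4) there is a uniquely determined subset $F\subseteq E(T)$ such that (a) every pendant edge of $T$ belongs to $F$; (b) $d_T(e,F\setminus\{e\})=3$ for every $e\in F$; (c) for any two distinct $e,f\in F$ there is a unique sequence $(e_0,e_1,\ldots,e_k)$ of elements of $F$ with $e_0=e$, $e_k=f$ and $d_T(e_{i-1},e_i)=3$ for all $i\in\{1,\ldots,k\}$.
   Context: A total dominating set (TD-set) of a graph $G$ is a set $S\subseteq V(G)$ such that every vertex of $G$ has a neighbor in $S$; $\gamma_t(G)$ is the minimum size of a TD-set. The total domination subdivision number $\mathrm{sd}_{\gamma_t}(G)$ is the minimum number of edges that must be subdivided (each edge subdivided at most once, i.e. replaced by a path of length 2 through a new vertex) in order to increase $\gamma_t$. For trees this number is $1$, $2$ or $3$, and a tree is said to be in Class $k$ if its total domination subdivision number is $k$. A leaf is a vertex of degree 1, a support vertex is a neighbor of a leaf, and a pendant edge is an edge joining a leaf to its support vertex. For vertex sets $X,Y$, $d_T(X,Y)=\min\{d_T(x,y):x\in X,y\in Y\}$; the distance between edges $e_1=u_1v_1$ and $e_2=u_2v_2$ is $d_T(\{u_1,v_1\},\{u_2,v_2\})$, and for a set $F$ of edges $d_T(e,F)=\min_{f\in F}d_T(e,f)$. Family $\mathcal{T}$ (labeled trees, each vertex has a status in $\{A,B,C\}$): it contains the path $P_6$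 whose two leaves have status $C$, whose two support vertices have status $B$, and whose two central vertices have status $A$; and it is closed under: Operation $\mathcal{T}_1$: for a vertex $y$ of status $A$, add a new path $xwv$ and the edge $xy$, with statuses $x\colon A$, $w\colon B$, $v\colon C$; Operation $\mathcal{T}_2$: for a vertex $y$ of status $B$ or $C$, add a new path $xwvu$ and the edge $xy$, with statuses $x\colon A$, $w\colon A$, $v\colon B$, $u\colon C$. Family $\mathcal{O}$ (labeled trees, each vertex has status $A$ or $B$): it contains the path $P_6$ whose two central vertices have status $A$ and whose other four vertices have status $B$; and it is closed under: Operation $\mathcal{O}_1$: for a path $xyz$ in the current tree with $x,y$ of status $B$ and $z$ of status $A$, add a new path $abc$ and the edge $za$, with statuses $a\colon A$, $b\colon B$, $c\colon B$ (this identifies a B-B-A path of the tree with a B-B-A path of a labeled $P_6$); Operation $\mathcal{O}_2$: for an edge $xy$ of the current tree with both $x,y$ of status $B$, add a new path $abcd$ and the edge $dx$, with statuses $a\colon B$, $b\colon B$, $c\colon A$, $d\colon A$ (this identifies a B-B edge of the tree with a B-B edge of a labeled $P_6$). For an unlabeled tree $T$, ''$T\in\mathcal{T}$'' (resp. ''$T\in\mathcal{O}$'') means $T$ is the underlying tree (labels removed) of some labeled tree in $\mathcal{T}$ (resp. $\mathcal{O}$).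
   Formalization: In (4)(c) the sequence (e_0,…,e_k) is required to have pairwise distinct terms; without this, repetitions such as (e,f,e,f) make uniqueness fail always, e.g. for P_6, which lies in both families. *)

(* Defs.v *)
From mathcomp Require Import all_boot.
Set Implicit Arguments. Unset Strict Implicit. Unset Printing Implicit Defensive.

Section Graph.
Variables (T : finType) (e : rel T).

Definition is_tree : Prop :=
  [/\ symmetric e, irreflexive e,
      (forall x y, connect e x y) &
      (forall p : seq T, uniq p -> 3 <= size p -> ~~ cycle e p)].

Definition edges : {set {set T}} := [set A : {set T} | [exists u, exists v, e u v && (A == [set u; v])]].

Definition leaf (v : T) : bool := #|[set w | e v w]| == 1.

Definition pendant_edges : {set {set T}} :=
  [set A : {set T} | [exists u, exists v, [&& e u v, leaf v & A == [set u; v]]]].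

Fixpoint nwalk (k : nat) (x y : T) : bool :=
  if k is k'.+1 then [exists z, e x z && nwalk k' z y] else x == y.

(* graph distance (#|T| if unreachable; never happens in a tree) *)
Definition dist (x y : T) : nat :=
  \big[minn/#|T|]_(k < #|T| | nwalk k x y) (k : nat).

Definition setdist (X Y : {set T}) : nat :=
  \big[minn/#|T|]_(x in X) \big[minn/#|T|]_(y in Y) dist x y.

(* d_T(f, F) for an edge f and a set of edges F (#|T| if F is empty) *)
Definition edist_set (f : {set T}) (F : {set {set T}}) : nat :=
  \big[minn/#|T|]_(g in F) setdist f g.

Definition is_TD (U : finType) (V : {set U}) (r : rel U) (S : {set U}) : bool :=
  (S \subset V) && [forall v in V, exists w in S, r v w].

Definition gamma_t (U : finType) (V : {set U}) (r : rel U) : nat :=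
  \big[minn/#|V|.+1]_(S : {set U} | is_TD V r S) #|S|.

Definition sub_vertices (F : {set {set T}}) : {set (T + {set T})%type} :=
  [set inl x | x : T] :|: [set inr f | f in F].

Definition sub_rel (F : {set {set T}}) : rel (T + {set T})%type :=
  fun a b => match a, b with
  | inl x, inl y => e x y && ([set x; y] \notin F)
  | inl x, inr f => (f \in F) && (x \in f)
  | inr f, inl x => (f \in F) && (x \in f)
  | inr _, inr _ => false
  end.

Definition increases_gamma_t (F : {set {set T}}) : bool :=
  gamma_t [set: T] e < gamma_t (sub_vertices F) (sub_rel F).

Definition sd_gamma_t : nat :=
  \big[minn/#|edges|.+1]_(F : {set {set T}} | (F \subset edges) && increases_gamma_t F) #|F|.

Definition cond4_F (F : {set {set T}}) : Prop :=
  [/\ F \subset edges,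
      pendant_edges \subset F,
      (forall f, f \in F -> edist_set f (F :\ f) = 3) &
      (forall f g, f \in F -> g \in F -> f != g ->
         exists! s : seq {set T},
           [/\ all (fun h => h \in F) s, uniq (f :: s),
               path (fun a b => setdist a b == 3) f s & last f s = g])].

Definition cond4 : Prop := exists! F : {set {set T}}, cond4_F F.

End Graph.

Inductive status := SA | SB | SC.

Definition addE (r : rel nat) (x y : nat) : rel nat :=
  fun a b => r a b || ((a == x) && (b == y)) || ((a == y) && (b == x)).

Definition upd (lab : nat -> status) (i : nat) (s : status) : nat -> status :=
  fun j => if j == i then s else lab j.

Definition adjP6 : rel nat :=
  fun a b => [&& (a.+1 == b) || (b.+1 == a), a < 6 & b < 6].

Definition labT6 : nat -> status :=
  fun i => if (i == 0) || (i == 5) then SC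
           else if (i == 1) || (i == 4) then SB else SA.

Definition labO6 : nat -> status :=
  fun i => if (i == 2) || (i == 3) then SA else SB.

Inductive famT : forall n : nat, rel nat -> (nat -> status) -> Prop :=
| famT_P6 : famT 6 adjP6 labT6
| famT_op1 n r lab y : famT n r lab -> y < n -> lab y = SA ->
    (* new path x w v = n, n+1, n+2, edge xy *)
    famT (n + 3) (addE (addE (addE r y n) n n.+1) n.+1 n.+2)
         (upd (upd (upd lab n SA) n.+1 SB) n.+2 SC)
| famT_op2 n r lab y : famT n r lab -> y < n -> (lab y = SB \/ lab y = SC) ->
    (* new path x w v u = n, n+1, n+2, n+3, edge xy *)
    famT (n + 4) (addE (addE (addE (addE r y n) n n.+1) n.+1 n.+2) n.+2 n.+3)
         (upd (upd (upd (upd lab n SA) n.+1 SA) n.+2 SB) n.+3 SC).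

Inductive famO : forall n : nat, rel nat -> (nat -> status) -> Prop :=
| famO_P6 : famO 6 adjP6 labO6
| famO_op1 n r lab x y z : famO n r lab -> x < n -> y < n -> z < n ->
    r x y -> r y z -> x != z -> lab x = SB -> lab y = SB -> lab z = SA ->
    (* new path a b c = n, n+1, n+2, edge za *)
    famO (n + 3) (addE (addE (addE r z n) n n.+1) n.+1 n.+2)
         (upd (upd (upd lab n SA) n.+1 SB) n.+2 SB)
| famO_op2 n r lab x y : famO n r lab -> x < n -> y < n -> r x y ->
    lab x = SB -> lab y = SB ->
    (* new path a b c d = n, n+1, n+2, n+3, edge dx *)
    famO (n + 4) (addE (addE (addE (addE r n n.+1) n.+1 n.+2) n.+2 n.+3) n.+3 x)
         (upd (upd (upd (upd lab n SB) n.+1 SB) n.+2 SA) n.+3 SA).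

Definition in_famT (T : finType) (e : rel T) : Prop :=
  exists n r lab, famT n r lab /\
    exists f : T -> 'I_n, bijective f /\ forall u v, e u v = r (f u) (f v).

Definition in_famO (T : finType) (e : rel T) : Prop :=
  exists n r lab, famO n r lab /\
    exists f : T -> 'I_n, bijective f /\ forall u v, e u v = r (f u) (f v).

(* Main.v *)
Require Import Defs.
From mathcomp Require Import all_boot zify.
Set Implicit Arguments. Unset Strict Implicit. Unset Printing Implicit Defensive.

(** Every condition is equivalent to the existence of a set B of vertices such that each
    vertex has exactly one neighbour in B and no vertex outside B is a leaf (a total
    perfect code containing the leaves); B consists of the vertices covered by F, i.e. of
    those with status B or C, and F is the perfect matching that B induces.

    In a tree gamma_t equals the maximum size of an open packing, and gamma_t = |B| when B
    exists. If a maximum open packing P misses a vertex w, subdividing at most two edges at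
    a neighbour of w makes room for a further packing vertex; if P misses a leaf, exchange
    arguments reach the same conclusion. So class 3 yields B. Conversely, any set of at most
    two edges is the boundary of a subtree M, and shifting B away from M outside M totally
    dominates the subdivided tree; while subdividing the three edges at the end of a deepest
    branch makes room for a packing of size |B| + 1.

    Contracting the edges of F together with the vertices attached to them turns T into a
    tree on F whose edges are the pairs at distance 3. This gives condition 4 and the
    generation of T by the operations of both families. *)

(** * Open packings and total domination *)

Section BigMin.
Variables (I : finType) (d : nat) (P : pred I) (F : I -> nat).

Lemma bigmin_inf i : P i -> \big[minn/d]_(j | P j) F j <= F i.
Proof.
move=> Pi; elim: (index_enum I) (mem_index_enum i) => // j s IHs.
rewrite inE big_cons => /predU1P[<-|/IHs]; first by rewrite Pi geq_minl.
by case: ifP => // _ /(leq_trans _); apply; rewrite geq_minr.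
Qed.

Lemma bigmin_leP k :
  reflect (k <= d /\ forall i, P i -> k <= F i) (k <= \big[minn/d]_(i | P i) F i).
Proof.
apply: (iffP idP) => [le_k | [le_kd le_kF]]; last first.
  by elim/big_ind: _ => // x y le_x le_y; rewrite leq_min le_x.
split=> [|i Pi]; last exact: leq_trans le_k (bigmin_inf Pi).
apply: leq_trans le_k _.
by elim/big_rec: _ => // i x _; apply: leq_trans; rewrite geq_minr.
Qed.

(** A value strictly below [d] cannot be the default, so some index produces it. *)
Lemma bigmin_attained :
  \big[minn/d]_(i | P i) F i < d -> exists2 i, P i & \big[minn/d]_(i | P i) F i = F i.
Proof.
elim/big_ind: _ => [|x y IHx IHy|i Pi _]; rewrite ?ltnn //; last by exists i.
by case: (leqP x y).
Qed.

End BigMin.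

Section OpenPacking.
Variables (U : finType) (V : {set U}) (r : rel U).

(** The notion dual to total domination: the open neighbourhoods of the members are pairwise
    disjoint within [V]. *)
Definition open_packing (P : {set U}) :=
  P \subset V /\ forall p q w, p \in P -> q \in P -> w \in V -> r p w -> r q w -> p = q.

(** Weak duality: choosing a dominator in [S] for each packing vertex is injective. *)
Lemma open_packing_TD P S : open_packing P -> is_TD V r S -> #|P| <= #|S|.
Proof.
move=> [sPV packP] /andP[sSV /forall_inP domS].
have [h hP] : exists h : U -> U, forall p, p \in P -> (h p \in S) && r p (h p).
  apply: (@fin_all_exists _ (fun _ => U) (fun p w => p \in P -> (w \in S) && r p w)) => p.
  case: (boolP (p \in P)) => [pP|_]; last by exists p.
  by have /exists_inP[w wS rpw] := domS p (subsetP sPV p pP); exists w; rewrite wS.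
have inj_h : {in P &, injective h}.
  move=> p q pP qP eq_h; have /andP[hS rp] := hP p pP; have /andP[_ rq] := hP q qP.
  by apply: (packP p q (h p)) => //; [apply: (subsetP sSV) | rewrite eq_h].
rewrite -(card_in_imset inj_h); apply/subset_leq_card/subsetP => _ /imsetP[p pP ->].
by have /andP[] := hP p pP.
Qed.

Lemma open_packing_gamma_t P : open_packing P -> #|P| <= gamma_t V r.
Proof.
move=> packP; apply/bigmin_leP; split=> [|S]; last exact: open_packing_TD.
(* The default [#|V|.+1] of [gamma_t] exceeds [#|P|] because [P] lies in [V]. *)
by case: packP => /subset_leq_card/leqW.
Qed.

Lemma TD_gamma_t S : is_TD V r S -> gamma_t V r <= #|S|.
Proof. exact: bigmin_inf. Qed.

End OpenPacking.

Lemma set2_mem (T : finType) (x y u v : T) : [set x; y] = [set u; v] ->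
  (x = u /\ y = v) \/ (x = v /\ y = u).
Proof.
move=> E; have := set22 u v; have := set21 u v; rewrite -{1 2}E.
have := set22 x y; have := set21 x y; rewrite {1 2}E !inE.
move=> /orP[]/eqP ? /orP[]/eqP ? /orP[]/eqP ? /orP[]/eqP ?;
  solve [left; split; congruence | right; split; congruence].
Qed.

(** * Rooted trees *)

Section Tree.
Variables (T : finType) (e : rel T).

(** The root is its own parent, so [par] is total and the clauses on parent edges and depth exempt
    the root. *)
Definition rooted r (par : T -> T) (dep : T -> nat) :=
  [/\ par r = r, (forall x, x != r -> e x (par x)),
      (forall x, x != r -> dep x = (dep (par x)).+1) &
      (forall x y, e x y -> par x = y \/ par y = x)].

Definition without_edge x y := [rel a b | e a b && ([set a; b] != [set x; y])].

Hypothesis tr : is_tree e.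

Let symE : symmetric e. Proof. by case: tr. Qed.
Let irrE x : e x x = false. Proof. by case: tr => _ /(_ x). Qed.

(** A path avoiding the edge [xy], once shortened to a simple one, has at least three vertices and
    closes up with [xy] to a cycle. *)
Lemma tree_bridge x y : e x y -> ~~ connect (without_edge x y) x y.
Proof.
move=> exy; apply/negP => /connectP[p0 pth0]; case/shortenP: pth0 => p pth Up _ lst.
case: tr => _ _ _ /(_ (x :: p) Up).
case: p pth Up lst => [|z [|t p]] /=.
- by move=> _ _ yx; rewrite yx irrE in exy.
- by move=> + _ lst; rewrite lst eqxx !andbF.
move=> pth _ lst /(_ isT)/negP; apply.
have sub : subrel (without_edge x y) e by move=> a b /andP[].
rewrite rcons_path -lst [e y x]symE exy andbT.
by case/and3P: pth => /sub-> /sub-> /(sub_path sub).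
Qed.

(** Depth is the length of a shortest walk to [r], and [par] is the next vertex on one. If an edge
    [xy] were no parent edge, the parent chains from [x] and [y] to [r] would bypass it, although it
    is a bridge. *)
Lemma tree_rooted r : exists par dep, rooted r par dep.
Proof.
have ex_walk x : exists k, nwalk e k x r.
  case: tr => _ _ /(_ x r)/connectP[p pth lst] _; elim: p x pth lst => [|z p IHp] x /=.
    by move=> _ ->; exists 0; rewrite /= eqxx.
  case/andP=> exz /IHp{}IHp /IHp[k wk]; exists k.+1; apply/existsP; exists z.
  by rewrite exz.
pose dep x := ex_minn (ex_walk x).
have depP x : nwalk e (dep x) x r by rewrite /dep; case: ex_minnP.
have dep_le x k : nwalk e k x r -> dep x <= k by rewrite /dep; case: ex_minnP => m _; apply.
have [par parP] : exists par : T -> T, forall x,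
    if x == r then par x = r else e x (par x) /\ dep x = (dep (par x)).+1.
  apply: (@fin_all_exists _ (fun _ => T)
    (fun x p => if x == r then p = r else e x p /\ dep x = (dep p).+1)) => x.
  case: eqP => [_|/eqP xr]; first by exists r.
  have := depP x; case E: (dep x) => [|k] /=; first by rewrite (negPf xr).
  case/existsP=> z /andP[exz wk]; exists z; split=> //.
  apply/eqP; rewrite eqSS eqn_leq dep_le // andbT -ltnS -E dep_le //=.
  by apply/existsP; exists z; rewrite exz depP.
have par_r : par r = r by have := parP r; rewrite eqxx.
have par_e x : x != r -> e x (par x) by have := parP x; case: eqP => // _ [].
have par_d x : x != r -> dep x = (dep (par x)).+1 by have := parP x; case: eqP => // _ [].
exists par, dep; split=> // x y exy.
case: (eqVneq (par x) y) => [|nxy]; first by left.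
case: (eqVneq (par y) x) => [|nyx]; first by right.
have to_r z : connect (without_edge x y) z r.
  have [k] := ubnP (dep z); elim: k z => // k IHk z; case: (eqVneq z r) => [-> //|zr] le_z.
  apply: (connect_trans (y := par z)); last by apply: IHk; rewrite (par_d z zr) in le_z.
  apply: connect1; rewrite /= par_e //=; apply/eqP => /set2_mem[[zx py]|[zy px]].
    by rewrite -zx py eqxx in nxy.
  by rewrite -zy px eqxx in nyx.
have csym : connect_sym (without_edge x y).
  by apply: sym_connect_sym => a b /=; rewrite symE setUC.
case/negP: (tree_bridge exy); apply: connect_trans (to_r x) _.
by rewrite csym.
Qed.

End Tree.

(** * Branches of a rooted tree *)

Section Rooted.
Variables (T : finType) (e : rel T) (r : T) (par : T -> T) (dep : T -> nat).
Hypotheses (symE : symmetric e) (irrE : irreflexive e) (root : rooted e r par dep).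

Lemma par_edge x : x != r -> e x (par x). Proof. by case: root => _ /(_ x). Qed.

Lemma dep_par x : x != r -> dep x = (dep (par x)).+1.
Proof. by case: root => _ _ /(_ x). Qed.

Lemma edge_par x y : e x y -> (par x = y /\ x != r) \/ (par y = x /\ y != r).
Proof.
case: root => par_r _ _ all_par exy.
have nr u v : e u v -> par u = v -> u != r.
  by move=> euv pu; apply: contraTneq euv => ur; rewrite -pu ur par_r irrE.
by case: (all_par x y exy) => pxy; [left | right]; split=> //;
  [apply: nr pxy | apply: nr pxy; rewrite symE].
Qed.

Lemma child_par x y : e x y -> par x != y -> par y = x /\ y != r.
Proof. by move=> /edge_par[[-> _]|//]; rewrite eqxx. Qed.

(** The branch at [y], including [y] itself: iterating [par] from [z] reaches [y]. *)
Definition desc y z := fconnect par z y.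

Lemma desc_par y z : desc y (par z) -> desc y z.
Proof. by apply: connect_trans; apply: fconnect1. Qed.

Lemma descP y z : desc y z -> z = y \/ desc y (par z).
Proof.
case/connectP=> [[|a p]] /=; first by move=> _ ->; left.
by case/andP=> /eqP-> pth lst; right; apply/connectP; exists p.
Qed.

Lemma desc_dep y z : desc y z -> z = y \/ dep y < dep z.
Proof.
case/connectP=> p; elim: p z => [|a p IHp] z /=; first by move=> _ ->; left.
case/andP=> /eqP pz pth lst; have [zr|zr] := eqVneq z r.
  have az : a = z by case: root => par_r _ _ _; rewrite -pz zr.
  by apply: IHp; rewrite -?az.
by right; rewrite (dep_par zr) pz ltnS; case: (IHp a pth lst) => [<-|/ltnW].
Qed.

Lemma desc_root y : desc y r -> y = r.
Proof.
case/connectP=> p; case: root => par_r _ _ _.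
by elim: p => [|a p IHp] //=; rewrite par_r => /andP[/eqP<-].
Qed.

(** A branch contains the children of its members, so an edge can leave it only at the top. *)
Lemma desc_cross y z w : e z w -> desc y z -> ~~ desc y w -> z = y /\ w = par y.
Proof.
move=> /edge_par[[pz _]|[pw _]] dz dw.
  by case: (descP dz) => [zy|]; [split; rewrite // -zy | rewrite pz (negPf dw)].
by rewrite desc_par ?pw in dw.
Qed.

Lemma desc_parN y : y != r -> ~~ desc y (par y).
Proof.
move=> yr; apply/negP => /desc_dep; rewrite (dep_par yr) => -[py|].
  by have /eqP := dep_par yr; rewrite py -[_ == _]negbK neq_ltn ltnSn.
by rewrite ltnNge leqnSn.
Qed.

(** Induction on the maximal depth minus the depth of [v], which drops from a vertex to its
    children. *)
Lemma bottom_up_ind (P : T -> Prop) :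
  (forall v, (forall c, c != r -> par c = v -> P c) -> P v) -> forall v, P v.
Proof.
move=> step v; have [k] := ubnP (\max_x dep x - dep v).
elim: k v => // k IHk v lt_v; apply: step => c cr pc; apply: IHk.
have := leq_bigmax (F := dep) c; have := dep_par cr; rewrite pc.
by have := leq_bigmax (F := dep) v; lia.
Qed.

End Rooted.

(** * Strong duality in trees *)

Section Duality.
Variables (T : finType) (e : rel T).
Hypotheses (tr : is_tree e) (T_gt1 : 1 < #|T|).
Let symE : symmetric e. Proof. by case: tr. Qed.
Let irrE : irreflexive e. Proof. by case: tr. Qed.

Lemma tree_nbr x : exists y, e x y.
Proof.
have [y yx] : exists y, y != x.
  have /card_gt1P[y [z [_ _]]] := T_gt1.
  by have [->|] := eqVneq y x; [rewrite eq_sym; exists z | exists y].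
case: tr => _ _ /(_ x y)/connectP[[|z p]] /=; first by move=> _ E; rewrite E eqxx in yx.
by case/andP=> exz _ _ _; exists z.
Qed.

(* Greedy duality: the deepest vertex not yet dominated enters the packing, and its
   parent enters the dominating set. *)
Lemma tree_open_packing :
  exists P, open_packing [set: T] e P /\ #|P| = gamma_t [set: T] e.
Proof.
have [r _] : exists r : T, true by case/card_gt0P: (ltnW T_gt1) => r; exists r.
have [par [dep root]] := tree_rooted tr r.
(* The root has no proper parent; an arbitrary neighbour takes that role. *)
have [g0 eg0] := tree_nbr r; pose g x := if x == r then g0 else par x.
have eg x : e x (g x).
  by rewrite /g; case: (eqVneq x r) => [->|] //; apply: (par_edge root).
have [P [_ packP domP]] : exists P : {set T}, [/\ P \subset [set: T],
    (forall p q w, p \in P -> q \in P -> e p w -> e q w -> p = q) &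
    (forall x, x \in [set: T] -> exists2 p, p \in P & e x (g p))].
  (* The induction runs over sets [X] closed under deeper vertices. Setting aside a shallowest [v]
     preserves this, so [v] is treated after everything deeper. *)
  have: forall x y, x \in [set: T] -> dep x < dep y -> y \in [set: T].
    by move=> ? ? _ _; rewrite inE.
  move: [set: T] => X; have [n] := ubnP #|X|; elim: n X => // n IHn X ltX upX.
  have [->|[v0 v0X]] := set_0Vmem X.
    by by exists set0; split=> [|p q w|x]; rewrite ?sub0set ?inE.
  case: (@arg_minnP _ v0 (fun x => x \in X) dep v0X) => v vX minv.
  have [||P [sPX packP domP]] := IHn (X :\ v).
  - by rewrite (cardsD1 v X) vX in ltX.
  - move=> x y /setD1P[xv xX] lt_xy; rewrite !inE (upX x y) // andbT.
    by apply: contraTneq lt_xy => ->; rewrite -leqNgt minv.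
  have sPX' : P \subset X by apply: subset_trans sPX (subD1set _ _).
  case: (boolP [exists p in P, e v (g p)]) => [/exists_inP[p pP ep]|ndom].
    exists P; split=> // x xX; have [->|xv] := eqVneq x v; first by exists p.
    by apply: domP; rewrite !inE xv.
  (* A common neighbour of [v] and [q] is the parent of [q], and then [v] is already dominated, or a
     child of [q], and then [v] is deeper than [q] or equal to it. *)
  have apart q w : q \in P -> e v w -> e q w -> False.
    move=> qP evw eqw; have /setD1P[qv qX] := subsetP sPX q qP.
    case: (edge_par symE irrE root eqw) => [[pq qr]|[pw wr]].
      case/exists_inP: ndom; exists q => //; by rewrite /g (negPf qr) pq.
    case: (edge_par symE irrE root evw) => [[pv vr]|[pw' _]].
      by have := minv q qX; rewrite (dep_par root vr) pv (dep_par root wr) pw ltnNge leqnSn.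
    by rewrite -pw pw' eqxx in qv.
  exists (v |: P); split=> [|p q w|x xX].
  - by rewrite subUset sub1set vX.
  - move=> /setU1P[->|pP] /setU1P[->|qP] // epw eqw.
    + by case: (apart q w).
    + by case: (apart p w).
    + exact: packP epw eqw.
  - have [->|xv] := eqVneq x v; first by exists v; rewrite ?setU11.
    by have [|p pP ep] := domP x; [rewrite !inE xv | exists p; rewrite // setU1r].
have pP : open_packing [set: T] e P.
  by split=> [|p q w pP qP _]; [apply: subsetT | apply: packP].
exists P; split=> //; apply/eqP; rewrite eqn_leq open_packing_gamma_t //=.
apply: leq_trans (leq_imset_card g (mem P)); apply: TD_gamma_t.
apply/andP; split; first exact: subsetT.
apply/forall_inP => x _; have [|p pP' ep] := domP x; first by rewrite inE.
by apply/exists_inP; exists (g p); rewrite // imset_f.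
Qed.

End Duality.

(** * From class 3 to total perfect codes *)

Section LeafyCode.
Variables (T : finType) (e : rel T).

(* The third clause says that no vertex outside [B] is a leaf. *)
Definition leafy_code (B : {set T}) :=
  [/\ forall v, exists2 w, w \in B & e v w,
      forall v w w', w \in B -> w' \in B -> e v w -> e v w' -> w = w' &
      forall v, v \notin B -> exists2 w, w \notin B & e v w].

Lemma edges_set2 u v : e u v -> [set u; v] \in edges e.
Proof.
by move=> euv; rewrite inE; apply/existsP; exists u; apply/existsP; exists v; rewrite euv eqxx.
Qed.

Lemma edgesP f : reflect (exists u v, e u v /\ f = [set u; v]) (f \in edges e).
Proof.
rewrite inE; apply: (iffP existsP) => [[u /existsP[v /andP[euv /eqP->]]]|[u [v [euv ->]]]].
  by exists u, v.
by exists u; apply/existsP; exists v; rewrite euv eqxx.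
Qed.

(** The packing in the subdivided tree is [Q] together with the vertex subdividing [h]. The
    hypotheses exclude, in turn, common neighbours that are old vertices, common neighbours that are
    subdivision vertices, and ends of [h] still adjacent to a member of [Q]. *)
Lemma subdivision_packing (F : {set {set T}}) (h : {set T}) (Q : {set T}) :
  h \in F ->
  (forall p q w, p \in Q -> q \in Q -> e p w -> e q w ->
     [set p; w] \notin F -> [set q; w] \notin F -> p = q) ->
  (forall f p q, f \in F -> p \in Q -> q \in Q -> p \in f -> q \in f -> p = q) ->
  (forall q x, q \in Q -> x \in h -> e q x -> [set q; x] \in F) ->
  #|Q| < gamma_t (sub_vertices F) (sub_rel e F).
Proof.
move=> hF apartV apartF apart_h.
pose P := (inr h : T + {set T}) |: [set inl x | x in Q].
have cardP : #|P| = #|Q|.+1.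
  rewrite cardsU1 card_imset; last by move=> x y [].
  by case: imsetP => [[]|].
rewrite -cardP; apply: open_packing_gamma_t; split=> [|p q w].
  apply/subsetP => _ /setU1P[->|/imsetP[x _ ->]]; rewrite inE.
    by rewrite imset_f ?orbT.
  by rewrite imset_f.
case/setU1P=> [->|/imsetP[x xQ ->]] /setU1P[->|/imsetP[y yQ ->]] // _.
- case: w => //= w /andP[_ wh] /andP[eyw /negP[]]; exact: apart_h.
- case: w => //= w /andP[exw nF] /andP[_ wh]; case/negP: nF; exact: apart_h.
- case: w => /= [w /andP[exw nx] /andP[eyw ny]|f /andP[fF xf] /andP[_ yf]].
    by rewrite (apartV x y w).
  by rewrite (apartF f x y).
Qed.

Hypotheses (tr : is_tree e) (T_gt1 : 1 < #|T|).
Let symE : symmetric e. Proof. by case: tr. Qed.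
Let irrE : irreflexive e. Proof. by case: tr. Qed.

(** A maximum open packing turns out to be the code. Where domination or the leaf clause fails, at
    most two edges are found whose subdivision leaves room for one more packing vertex. *)
Lemma class3_leafy_code :
  (forall F : {set {set T}}, F \subset edges e -> #|F| <= 2 -> ~~ increases_gamma_t e F) ->
  exists B, leafy_code B.
Proof.
move=> no2; have [P [packP cardP]] := tree_open_packing tr T_gt1.
have no_larger (F : {set {set T}}) (h Q : {set T}) :
    F \subset edges e -> #|F| <= 2 -> #|Q| = #|P| -> h \in F ->
    (forall p q w, p \in Q -> q \in Q -> e p w -> e q w ->
       [set p; w] \notin F -> [set q; w] \notin F -> p = q) ->
    (forall f p q, f \in F -> p \in Q -> q \in Q -> p \in f -> q \in f -> p = q) ->
    (forall q x, q \in Q -> x \in h -> e q x -> [set q; x] \in F) -> False.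
  move=> sFE F2 cQ hF q1 q2 q3; have := subdivision_packing hF q1 q2 q3.
  by rewrite cQ cardP; apply/negP; apply: no2.
have pair_edges a b c d : e a b -> e c d ->
    [set [set a; b]; [set c; d]] \subset edges e /\ #|[set [set a; b]; [set c; d]]| <= 2.
  by move=> eab ecd; rewrite subUset !sub1set !edges_set2 // cards2; case: (_ != _).
(* Proved for every packing of maximum size, to be applied again after an exchange. If [w] has no
   neighbour in [Q], the edge [wu] and the edge from [u] to its neighbour in [Q] are subdivided. *)
have perfect (Q : {set T}) : open_packing [set: T] e Q -> #|Q| = #|P| ->
    forall w, exists2 p, p \in Q & e w p.
  move=> [_ packQ] cQ w.
  case: (boolP [exists p in Q, e w p]) => [/exists_inP//|/exists_inP now].
  have [u ewu] := tree_nbr tr T_gt1 w.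
  have uQ : u \notin Q by apply/negP => uQ; apply: now; exists u.
  (* If [u] has no neighbour in [Q], then [w] serves as [p] and the two edges coincide. *)
  have [p [eup pP]] : exists p, e u p /\ forall q, q \in Q -> e u q -> q = p.
    case: (boolP [exists p in Q, e u p]) => [/exists_inP[p pQ eup]|/exists_inP nou].
      by exists p; split=> // q qQ euq; apply: (packQ q p u); rewrite ?inE // symE.
    by exists w; rewrite symE; split=> // q qQ euq; case: nou; exists q.
  have [sE c2] := pair_edges _ _ _ _ ewu eup.
  case: (no_larger _ [set w; u] Q sE c2 cQ).
  - exact: set21.
  - by move=> a b x aQ bQ eax ebx _ _; apply: (packQ a b x).
  - move=> f a b + aQ bQ; have [au bu]: a != u /\ b != u.
      by split; [apply: contraNneq uQ => <- | apply: contraNneq uQ => <-].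
    by case/set2P=> ->; rewrite !inE (negPf au) (negPf bu) ?orbF => /eqP-> /eqP->.
  - move=> q x qQ /set2P[->|->] eqx.
      by case: now; exists q; rewrite // symE.
    by rewrite (pP q) // 1?symE // setUC set22.
exists P; split; first exact: perfect.
  move=> v w w' wP w'P evw evw'; case: packP => _ packP.
  by apply: (packP w w' v); rewrite ?inE // symE.
(* A vertex [l] outside [P] with all neighbours in [P] has a single neighbour [s], since members of
   [P] have disjoint neighbourhoods. *)
move=> l lP; apply/exists_inP; apply/contraT => /exists_inP all_in.
have nbr_l x : e l x -> x \in P by move=> elx; apply/contraT => xP; case: all_in; exists x.
have [s sP els] := perfect P packP erefl l.
have [p pP esp] := perfect P packP erefl s.
case: (packP) => _ packE.
have only_s x : e l x -> x = s.
  by move=> elx; apply: (packE x s l); rewrite ?inE 1?symE ?nbr_l // symE.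
have only_p q : q \in P -> e q s -> q = p.
  by move=> qP eqs; apply: (packE q p s); rewrite ?inE // symE.
(* Exchanging [p] for [l] keeps the packing maximum, and [perfect] applied to the result shows that
   [p] is a leaf at [s]. *)
have packP2 : open_packing [set: T] e (l |: P :\ p).
  have apart q x : q \in P :\ p -> e l x -> e q x -> False.
    by case/setD1P=> qp qP /only_s-> /(only_p q qP) E; rewrite E eqxx in qp.
  split=> [|a b x /setU1P[->|aP] /setU1P[->|bP] _ eax ebx //]; first exact: subsetT.
  - by case: (apart b x).
  - by case: (apart a x).
  - by case/setD1P: aP => _ aP; case/setD1P: bP => _ bP; apply: (packE a b x).
have cardP2 : #|l |: P :\ p| = #|P|.
  by rewrite cardsU1 !inE (negPf lP) andbF (cardsD1 p P) pP.
have leaf_p x : e p x -> x = s.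
  move=> epx; have [y yP2 exy] := perfect _ packP2 cardP2 x.
  case/setU1P: yP2 => [yl|/setD1P[yp yP]]; first by apply: only_s; rewrite symE -yl.
  by case/eqP: yp; apply: (packE y p x); rewrite ?inE // symE.
have sl : l != s by apply: contraNneq lP => ->.
have ps : p != s by apply: contraTneq esp => ->; rewrite irrE.
(* With [l] and [p] both leaves at [s], replace [s] by [l] and subdivide [ls] and [sp]; the vertex
   on [ls] then enlarges the packing. *)
rewrite symE in esp; have [sE c2] := pair_edges _ _ _ _ els esp.
case: (no_larger _ [set l; s] (l |: P :\ s) sE c2).
- by rewrite cardsU1 !inE (negPf lP) andbF (cardsD1 s P) sP.
- exact: set21.
- move=> a b x /setU1P[->|/setD1P[_ aP]] /setU1P[->|/setD1P[_ bP]] // eax ebx;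
    last by move=> _ _; apply: (packE a b x).
    by rewrite (only_s x) // set21.
  by rewrite (only_s x) // set21.
- move=> f a b fF aQ bQ.
  have nos c : c \in l |: P :\ s -> c != s.
    by case/setU1P=> [->|/setD1P[]].
  case/set2P: fF => ->; rewrite !inE (negPf (nos a aQ)) (negPf (nos b bQ)) !orbF;
    by move=> /eqP-> /eqP->.
- move=> q x /setU1P[->|/setD1P[qs qP]] /set2P[->|->] eqx.
  + by rewrite irrE in eqx.
  + exact: set21.
  + by rewrite symE in eqx; rewrite (only_s q eqx) eqxx in qs.
  + by rewrite (only_p q qP eqx) set22.
Qed.

End LeafyCode.

(** * From total perfect codes to class 3 *)

Section CodeToClass3.
Variables (T : finType) (e : rel T) (B : {set T}).
Hypotheses (symE : symmetric e) (irrE : irreflexive e) (codeB : leafy_code e B).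

Lemma code_nbr : exists bn : T -> T,
  forall v, [/\ bn v \in B, e v (bn v) & forall w, w \in B -> e v w -> w = bn v].
Proof.
case: codeB => dom uniqB _; apply: (@fin_all_exists _ (fun _ => T)
  (fun v b => [/\ b \in B, e v b & forall w, w \in B -> e v w -> w = b])) => v.
by have [b bB evb] := dom v; exists b; split=> // w wB evw; apply: (uniqB v).
Qed.

(** A code is at once a total dominating set and an open packing. *)
Lemma gamma_t_code : gamma_t [set: T] e = #|B|.
Proof.
have [dom uniqB _] := codeB; apply/eqP; rewrite eqn_leq; apply/andP; split.
  apply: TD_gamma_t; rewrite /is_TD subsetT; apply/forall_inP => v _.
  by have [b bB evb] := dom v; apply/exists_inP; exists b.
apply: open_packing_gamma_t; split=> [|p q w pB qB _ epw eqw]; first exact: subsetT.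
by apply: (uniqB w); rewrite // symE.
Qed.

Section Boundary.
Variables (r : T) (par : T -> T) (dep : T -> nat) (M : {set T}).
Hypotheses (root : rooted e r par dep) (rM : r \in M) (upM : forall z, z \in M -> par z \in M).

(** Since [M] is closed under [par], every edge between [M] and its complement has its upper end in
    [M]. *)
Definition boundary : {set {set T}} := [set [set z; par z] | z in ~: M & par z \in M].

(* Outside [M] the code is shifted away from the root: the shifted set consists of the
   vertices outside [M] whose parent is not in [B]; one subdivision vertex is spent on
   each boundary edge whose lower end lies in [B]. *)
Lemma gamma_t_boundary : gamma_t (sub_vertices boundary) (sub_rel e boundary) <= #|B|.
Proof.
have [bn bnP] := code_nbr; have [_ _ outB] := codeB.
have bnB v : bn v \in B by case: (bnP v).
have ebn v : e v (bn v) by case: (bnP v).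
have bnE v w : w \in B -> e v w -> w = bn v by case: (bnP v) => _ _; apply.
have child := child_par symE irrE root.
have notr z : z \notin M -> z != r by apply: contraNneq => ->.
have epar z : z \notin M -> e z (par z) by move/notr/(par_edge root).
have up_out z : par z \notin M -> z \notin M by apply: contra; apply: upM.
have same z w : (z \in M) = (w \in M) -> [set z; w] \notin boundary.
  move=> E; apply/negP => /imsetP[x]; rewrite !inE => /andP[xM pM] /set2_mem[][zx wx];
    by move: E xM; rewrite zx wx pM; case: (x \in M).
pose sv z : T + {set T} := inr [set z; par z].
have bdy z : z \notin M -> par z \in M -> [set z; par z] \in boundary.
  by move=> zM pM; apply: imset_f; rewrite !inE zM.
(* Vertices of [M] and vertices whose parent is not in [B] stay. Any other [w] is the lower end of a
   matched pair and moves up two steps, or to the first subdivision vertex met on the way. *)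
pose psi w := if (w \in M) || (par w \notin B) then inl w
  else if par w \in M then sv w
  else if par (par w) \in M then sv (par w) else inl (par (par w)).
pose D := psi @: B.
have D_M z : z \in B -> z \in M -> inl z \in D.
  by move=> zB zM; apply/imsetP; exists z; rewrite // /psi zM.
have D_low z : z \notin M -> par z \notin B -> inl z \in D.
  move=> zM pB; have [zB|zB] := boolP (z \in B).
    by apply/imsetP; exists z; rewrite // /psi pB orbT.
  (* The code neighbour of [z] is a child of [z], and the vertex matched with that child lies one
     level further down; the latter is moved to [z]. *)
  have [pb _] : par (bn z) = z /\ bn z != r.
    by apply: child => //; apply: contraNneq pB => ->.
  have bM : bn z \notin M by apply: up_out; rewrite pb.
  have [pc _] : par (bn (bn z)) = bn z /\ bn (bn z) != r.
    by apply: child => //; rewrite pb; apply: contraNneq zB => ->.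
  have cM : bn (bn z) \notin M by apply: up_out; rewrite pc.
  apply/imsetP; exists (bn (bn z)) => //.
  by rewrite /psi pc pb bnB (negPf cM) (negPf bM) (negPf zM).
have D_sv z : z \in B -> z \notin M -> par z \in M -> sv z \in D.
  move=> zB zM pM; have [pB|pB] := boolP (par z \in B).
    by apply/imsetP; exists z; rewrite // /psi pB pM (negPf zM).
  have [pw _] : par (bn z) = z /\ bn z != r.
    by apply: child => //; apply: contraNneq pB => ->.
  have wM : bn z \notin M by apply: up_out; rewrite pw.
  apply/imsetP; exists (bn z) => //.
  by rewrite /psi pw zB (negPf wM) (negPf zM) pM.
apply: leq_trans (leq_imset_card psi (mem B)); apply: TD_gamma_t; apply/andP; split.
  apply/subsetP => _ /imsetP[w _ ->]; rewrite /psi !inE.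
  case: ifP => [_|/norP[wM _]]; first by rewrite imset_f.
  case: ifP => [pM|/negbT pM]; first by rewrite [X in _ || X]imset_f ?orbT ?bdy.
  case: ifP => [ppM|_]; first by rewrite [X in _ || X]imset_f ?orbT ?bdy.
  by rewrite imset_f.
apply/forall_inP => v; rewrite inE => /orP[/imsetP[z _ ->]|/imsetP[f fF ->]]; last first.
  have /imsetP[y] := fF; rewrite !inE => /andP[yM pM] fE.
  have [pB|pB] := boolP (par y \in B); apply/exists_inP.
    by exists (inl (par y)); rewrite ?D_M //= fF fE set22.
  by exists (inl y); rewrite ?D_low //= fF fE set21.
have by_low x : e z x -> z \notin M -> x \notin M -> par x \notin B ->
    exists2 w, w \in D & sub_rel e boundary (inl z) w.
  move=> ezx zM xM pB; exists (inl x); first exact: D_low.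
  by rewrite /= ezx same // (negPf zM) (negPf xM).
apply/exists_inP; have [zM|zM] := boolP (z \in M).
  have [wM|wM] := boolP (bn z \in M).
    by exists (inl (bn z)); rewrite ?D_M //= ebn same // zM.
  have [pw _] : par (bn z) = z /\ bn z != r.
    by apply: child => //; apply: contraNneq wM => <-; apply: upM.
  exists (sv (bn z)); first by apply: D_sv; rewrite ?pw.
  have bd : [set bn z; par (bn z)] \in boundary by apply: bdy; rewrite ?pw.
  by rewrite /= bd -[X in X \in _]pw set22.
have by_par : z \in B -> exists2 w, w \in D & sub_rel e boundary (inl z) w.
  move=> zB; have [qM|qM] := boolP (par z \in M).
    by exists (sv z); [apply: D_sv | rewrite /= bdy // set21].
  apply: (by_low (par z)) => //; first exact: epar.
  apply/negP => ppB; have pp : par (par z) = z.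
    transitivity (bn (par z)); first exact: bnE ppB (epar _ qM).
    by apply/esym/bnE; rewrite // symE epar.
  have /eqP := dep_par root (notr _ zM); rewrite (dep_par root (notr _ qM)) pp.
  by rewrite -[_ == _]negbK neq_ltn ltnS leqnSn.
have [zB|zB] := boolP (z \in B); first exact: by_par.
have [wE|nw] := eqVneq (par z) (bn z).
  (* The code neighbour of [z] is its parent, so the neighbour outside [B] is a child; it belongs to
     the shifted set because [z] is not in [B]. *)
  have [z' z'B ezz'] := outB z zB.
  have [pz _] : par z' = z /\ z' != r.
    by apply: child => //; apply: contraNneq z'B => <-; rewrite wE.
  by apply: (by_low z'); rewrite ?pz //; apply: up_out; rewrite pz.
have [pw _] := child z (bn z) (ebn z) nw.
by apply: (by_low (bn z)); rewrite ?pw //; apply: up_out; rewrite pw.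
Qed.

End Boundary.

Hypotheses (tr : is_tree e).

(** For nonempty [F] the tree is rooted at the end of the first edge that faces the second one. Then
    neither of the two lower ends is a proper descendant of the other, and [M] is what remains after
    removing both branches. *)
Lemma two_edges_boundary (F : {set {set T}}) (x0 : T) : F \subset edges e -> #|F| <= 2 ->
  exists r par dep (M : {set T}), [/\ rooted e r par dep, r \in M,
    forall z, z \in M -> par z \in M & F = boundary par M].
Proof.
move=> sFE cF; have [F0|[f fF]] := set_0Vmem F.
  have [par [dep root]] := tree_rooted tr x0; exists x0, par, dep, setT.
  split=> //.
  by rewrite F0; apply/esym/setP => g; rewrite inE; apply/imsetP => -[z]; rewrite !inE.
have /edgesP[x [y [exy fE]]] := subsetP sFE f fF.
(* A single edge is listed twice, as [f] and as [uv]. *)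
have [u [v [euv Fsub gF]]] : exists u v,
    [/\ e u v, F \subset [set f; [set u; v]] & [set u; v] \in F].
  have [F1|[g /setD1P[gf gF]]] := set_0Vmem (F :\ f).
    exists x, y; split; rewrite -?fE //; apply/subsetP => g gF; rewrite !inE.
    by apply: contraT => gf; rewrite orbb in gf; rewrite -(in_set0 g) -F1 !inE gf.
  have /edgesP[u [v [euv gE]]] := subsetP sFE g gF; exists u, v; rewrite -gE; split=> //.
  have /eqP <- // : [set f; g] == F.
  by rewrite eqEcard subUset !sub1set fF gF cards2 eq_sym gf.
have FE : F = [set f; [set u; v]].
  by apply/eqP; rewrite eqEsubset Fsub subUset !sub1set fF gF.
have csym : connect_sym (without_edge e x y).
  by apply: sym_connect_sym => a b /=; rewrite symE setUC.
(* One end of the first edge reaches [u] without using that edge; call it [x]. *)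
wlog con_xu : x y exy fE csym / connect (without_edge e x y) x u.
  move=> gen; have [|/negP ncon] := boolP (connect (without_edge e x y) x u); first exact: gen.
  have eq_we : without_edge e y x =2 without_edge e x y by move=> a b /=; rewrite (setUC [set y]).
  apply: (gen y x); rewrite ?(symE y) // 1?setUC //.
    by move=> a b; rewrite !(eq_connect eq_we) csym.
  rewrite (eq_connect eq_we).
  have [par [dep root]] := tree_rooted tr x.
  have [py yx] : par y = x /\ y != x.
    apply: (child_par symE irrE root) => //; case: root => -> *.
    by apply: contraTneq exy => ->; rewrite irrE.
  have to_xy z : connect (without_edge e x y) x z \/ connect (without_edge e x y) y z.
    have [k] := ubnP (dep z); elim: k z => // k IHk z ltz.
    have [->|zx] := eqVneq z x; first by left.
    have [->|zy] := eqVneq z y; first by right.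
    have pe : connect (without_edge e x y) (par z) z.
      apply: connect1; rewrite /= symE (par_edge root) //=; apply/eqP.
      by case/set2_mem=> -[_ E]; rewrite E eqxx in zx zy.
    case: (IHk (par z)); first by rewrite (dep_par root zx) in ltz.
      by move=> c; left; apply: connect_trans c pe.
    by move=> c; right; apply: connect_trans c pe.
  by case: (to_xy u).
have [par [dep root]] := tree_rooted tr x.
have [py yx] : par y = x /\ y != x.
  apply: (child_par symE irrE root) => //; case: root => -> *.
  by apply: contraTneq exy => ->; rewrite irrE.
have out_y z : connect (without_edge e x y) x z -> ~~ desc par y z.
  case/connectP=> p; elim/last_ind: p z => [|p a IHp] z /=.
    by move=> _ ->; apply: contra yx => /(desc_root root)->.
  rewrite rcons_path last_rcons => /andP[pth /andP[ez nE]] ->.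
  have nd := IHp _ pth erefl; apply/negP => da; rewrite symE in ez.
  have [az lz] := desc_cross symE irrE root ez da nd.
  by rewrite /= lz az py eqxx in nE.
have [w [wx wF wy]] : exists w, [/\ w != x, [set u; v] = [set w; par w] &
    w = y \/ ~~ desc par y w].
  case: (edge_par symE irrE root euv) => -[pE nx].
    by exists u; rewrite pE; split=> //; right; apply: out_y.
  exists v; rewrite pE setUC; split=> //.
  have [dv|] := boolP (desc par y v); [left | by right].
  by case: (desc_cross symE irrE root _ dv (out_y u con_xu)); rewrite // symE.
exists x, par, dep, [set z | ~~ desc par y z && ~~ desc par w z].
have x_top t : t != x -> ~~ desc par t x by apply: contra => /(desc_root root)->.
have par_up := desc_parN root.
split=> // [|z|].
- by rewrite inE !x_top.
- rewrite !inE => /andP[ny nw].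
  by rewrite (contra (@desc_par _ _ _ _) ny) (contra (@desc_par _ _ _ _) nw).
rewrite FE fE wF; apply/setP => g; rewrite !inE; apply/orP/imsetP.
  have y_bdy : y \in ~: [set z | ~~ desc par y z && ~~ desc par w z] /\
      par y \in [set z | ~~ desc par y z && ~~ desc par w z].
    by rewrite !inE /desc connect0 -/(desc _ _ _) par_up // py x_top.
  case=> /eqP->; first by exists y; [rewrite inE; apply/andP | rewrite py setUC].
  case: wy => [wy|nyw].
    by exists y; [rewrite inE; apply/andP | rewrite wy].
  exists w => //; rewrite !inE negb_and !negbK [desc par w w]connect0 orbT /= par_up // andbT.
  by apply: contra nyw; apply: desc_par.
case=> z; rewrite !inE negb_and !negbK => /andP[dz /andP[npy npw]] ->.
case/orP: dz => /descP[]; rewrite ?(negPf npy) ?(negPf npw) // => ->.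
  by rewrite py setUC eqxx; left.
by rewrite eqxx; right.
Qed.

End CodeToClass3.

Lemma tree_exit (T : finType) (e : rel T) (X : {set T}) x : is_tree e -> x \in X -> X != setT ->
  exists u v, [/\ u \in X, v \notin X & e u v].
Proof.
move=> [_ _ con _] xX /eqP nX.
case: (boolP [exists u in X, exists v, (v \notin X) && e u v]) => [|/exists_inP no].
  by case/exists_inP=> u uX /existsP[v /andP[vX euv]]; exists u, v.
case: nX; apply/setP => z; rewrite inE; have /connectP[p pth ->] := con x z.
elim: p x xX pth => //= y p IHp x xX /andP[exy /IHp]; apply.
by apply/contraT => yX; case: no; exists x => //; apply/existsP; exists y; rewrite yX.
Qed.

(** * Three subdivisions at the end of a deepest branch *)

Section Class3.
Variables (T : finType) (e : rel T) (B : {set T}).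
Hypotheses (tr : is_tree e) (T_gt2 : 2 < #|T|) (codeB : leafy_code e B).
Let symE : symmetric e. Proof. by case: tr. Qed.
Let irrE : irreflexive e. Proof. by case: tr. Qed.

(** Here [c] is a deepest vertex, [b] its parent and [a] its grandparent. Every vertex of maximal
    depth is a leaf, so it and its parent lie in [B]; with uniqueness of code neighbours this leaves
    [c] as the only child of [b] and [b] as the only child of [a]. *)
Lemma code_end_path : exists c b a a',
  [/\ c \in B /\ b \in B, a \notin B /\ a' \notin B,
      e c b /\ e b a /\ e a a',
      (forall x, e b x -> x = c \/ x = a) & (forall x, e a x -> x = b \/ x = a')].
Proof.
have [dom uniqB outB] := codeB.
have [r _] : exists r : T, true by case/card_gt0P: (ltnW (ltnW T_gt2)) => r; exists r.
have [par [dep root]] := tree_rooted tr r; have [par_r _ _ _] := root.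
case: (@arg_maxnP _ r xpredT dep erefl) => c _ max_c.
have maxc x : dep x <= dep c by apply: max_c.
have deep v : v != r -> dep v = dep c ->
    [/\ v \in B, par v \in B & forall x, e v x -> x = par v].
  move=> vr dv; have only x : e v x -> x = par v.
    case/(edge_par symE irrE root)=> -[// px xr].
    by have := maxc x; rewrite (dep_par root xr) px dv ltnn.
  have [w wB /only wE] := dom v; rewrite wE in wB; split=> //.
  apply/contraT => /outB[w' w'B /only w'E].
  by rewrite w'E wB in w'B.
have cr : c != r.
  apply/eqP => cr; have [x erx] := tree_nbr tr (ltnW T_gt2) r.
  have [[px rr]|[px xr]] := edge_par symE irrE root erx; first by rewrite eqxx in rr.
  by have := maxc x; rewrite (dep_par root xr) px cr ltnn.
have [cB bB only_c] := deep c cr erefl; have ecb := par_edge root cr.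
set b := par c in bB only_c ecb; have dc := dep_par root cr; rewrite -/b in dc.
have deep_b x : x != r -> par x = b -> x = c.
  move=> xr px; have [|xB _ _] := deep x xr; first by rewrite (dep_par root xr) px.
  have ebx : e b x by rewrite symE -[b]px (par_edge root).
  by apply: (uniqB b) => //; rewrite symE.
have br : b != r.
  apply/eqP => br; have [||u [v [uX vX euv]]] := @tree_exit _ e [set c; b] c tr.
  - exact: set21.
  - by apply: contraTneq T_gt2 => E; rewrite -cardsT -E cards2; case: (_ != _).
  have vE : v != c /\ v != b by apply/norP; rewrite -in_set2.
  case/set2P: uX euv => -> ev; first by case: vE => _ /eqP[]; apply: only_c.
  have [[pb]|[pv vr]] := edge_par symE irrE root ev; first by rewrite br eqxx.
  by case: vE => /eqP[]; apply: deep_b.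
set a := par b; have eba : e b a := par_edge root br.
have db : dep b = (dep a).+1 := dep_par root br.
have aB : a \notin B.
  apply/negP => aB; have ac : a = c by apply: (uniqB b); rewrite // symE.
  by move: db; rewrite ac dc => /eqP; rewrite -[_ == _]negbK neq_ltn ltnS leqnSn.
have nbr_b x : e b x -> x = c \/ x = a.
  case/(edge_par symE irrE root)=> -[px xr]; first by right.
  by left; apply: deep_b.
have child_a x : e a x -> x != r -> par x = a -> x = b.
  move=> eax xr px; have [xB|xB] := boolP (x \in B).
    by apply: (uniqB a); rewrite // symE.
  have [y yB exy] := dom x; case/(edge_par symE irrE root): (exy) => -[py yr].
    by rewrite -py px (negPf aB) in yB.
  have [|_ + _] := deep y yr; first by rewrite dc db (dep_par root yr) py (dep_par root xr) px.
  by rewrite py (negPf xB).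
have [a' a'B eaa'] := outB a aB.
have a'E : par a = a'.
  case/(edge_par symE irrE root): (eaa') => -[// pa' a'r].
  by rewrite (child_a a') ?bB in a'B.
exists c, b, a, a'; split=> // x /[dup] eax /(edge_par symE irrE root)[][px xr].
  by right; rewrite -px.
by left; apply: child_a.
Qed.

Lemma code_class3 : sd_gamma_t e = 3.
Proof.
have [_ uniqB _] := codeB.
have [c [b [a [a' [[cB bB] [aB a'B] [ecb [eba eaa']] nbr_b nbr_a]]]]] := code_end_path.
have ab : a != b by apply: contraNneq aB => ->.
have sE : [set [set c; b]; [set b; a]] \subset edges e.
  by rewrite subUset !sub1set !edges_set2.
pose F := [set a; a'] |: [set [set c; b]; [set b; a]].
have sFE : F \subset edges e by rewrite subUset sub1set sE edges_set2.
have inF f : f \in F -> [\/ f = [set c; b], f = [set b; a] | f = [set a; a']].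
  by case/setU1P=> [->|/set2P[]->]; [constructor 3 | constructor 1 | constructor 2].
have [Fcb Fba Faa'] : [/\ [set c; b] \in F, [set b; a] \in F & [set a; a'] \in F].
  by rewrite !inE !eqxx !orbT.
have incF : increases_gamma_t e F.
  rewrite /increases_gamma_t (gamma_t_code symE codeB).
  (* Exchange [b] for [a]; once [cb], [ba] and [aa'] are subdivided, the vertex on [ba] can be added
     to this set. *)
  have -> : #|B| = #|a |: B :\ b|.
    by rewrite cardsU1 !inE (negPf aB) andbF (cardsD1 b B) bB.
  apply: (@subdivision_packing _ _ _ [set b; a]) => //.
  - move=> p q w /setU1P[->|/setD1P[_ pB]] /setU1P[->|/setD1P[_ qB]] // epw eqw;
      last by move=> _ _; apply: (uniqB w); rewrite // symE.
      by case: (nbr_a w) => // ->; rewrite ?Faa' // setUC Fba.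
    by case: (nbr_a w) => // -> _; rewrite ?Faa' // setUC Fba.
  - have notb x : x \in a |: B :\ b -> x != b /\ x != a'.
      case/setU1P=> [->|/setD1P[xb xB]]; split=> //.
        by apply: contraTneq eaa' => <-; rewrite irrE.
      by apply: contraNneq a'B => <-.
    move=> f p q fF /notb[pb pa'] /notb[qb qa'].
    by case: (inF f fF) => ->; rewrite !inE ?(negPf pb) ?(negPf qb) ?(negPf pa') ?(negPf qa')
         ?orbF /= => /eqP-> /eqP->.
  - move=> q x qQ /set2P[->|->] eqx.
      by case: (nbr_b q) => [|->|->] //; [rewrite symE | rewrite setUC].
    case: (nbr_a q) => [|qb|->]; first by rewrite symE.
      by move: qQ; rewrite qb !inE eqxx eq_sym (negPf ab).
    by rewrite setUC.
apply/eqP; rewrite eqn_leq; apply/andP; split.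
  apply: leq_trans (bigmin_inf _ _ (i := F) _) _; first by rewrite sFE.
  by rewrite cardsU1 cards2; case: (_ \notin _); case: (_ != _).
(* The default [#|edges e|.+1] is at least three because [cb] and [ba] are distinct edges. *)
apply/bigmin_leP; split=> [|G /andP[sGE]].
  rewrite ltnS; apply: leq_trans (subset_leq_card sE); rewrite cards2.
  case: eqP => // /set2_mem[[cb _]|[ca _]]; first by rewrite cb irrE in ecb.
  by rewrite -ca cB in aB.
rewrite leqNgt; apply: contraL => cG.
have [r [par [dep [M [root rM upM ->]]]]] := two_edges_boundary symE irrE tr c sGE cG.
rewrite /increases_gamma_t -leqNgt (gamma_t_code symE codeB).
exact: (gamma_t_boundary symE irrE codeB root rM upM).
Qed.

End Class3.

(** * Condition 4 *)

Lemma code_leaf (T : finType) (e : rel T) (B : {set T}) v p : leafy_code e B ->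
  (forall x, e v x -> x = p) -> v \in B /\ p \in B.
Proof.
move=> [dom _ outB] only; have [w wB /only wE] := dom v; rewrite wE in wB; split=> //.
by apply/contraT => /outB[w' w'B /only w'E]; rewrite w'E wB in w'B.
Qed.

(** The code is forced from the leaves upwards: a leaf is in it, and the parent of a vertex is in it
    exactly when none of the children of that vertex is. *)
Lemma code_unique (T : finType) (e : rel T) (B1 B2 : {set T}) : is_tree e -> 1 < #|T| ->
  leafy_code e B1 -> leafy_code e B2 -> B1 = B2.
Proof.
move=> tr T_gt1 code1 code2.
have symE : symmetric e by case: tr.
have irrE : irreflexive e by case: tr.
have [r _] : exists r : T, true by case/card_gt0P: (ltnW T_gt1) => r; exists r.
have [par [dep root]] := tree_rooted tr r.
have transfer (X Y : {set T}) v : leafy_code e X -> leafy_code e Y ->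
    (forall w, w != r -> par w = v -> (w \in X) = (w \in Y)) ->
    v != r -> par v \in X -> par v \in Y.
  move=> [_ uniqX _] [domY _ _] agree vr pX; have [w wY evw] := domY v.
  case: (edge_par symE irrE root evw) => -[pw wr]; first by rewrite pw.
  suff -> : par v = w by [].
  by apply: (uniqX v) => //; [rewrite agree | apply: (par_edge root)].
have agree : forall v, v != r ->
    (v \in B1) = (v \in B2) /\ (par v \in B1) = (par v \in B2).
  apply: (bottom_up_ind root) => v IHv vr.
  have kids c : c != r -> par c = v -> (c \in B1) = (c \in B2).
    by move=> cr pc; case: (IHv c cr pc).
  split; last by apply/idP/idP; apply: transfer => // c cr pc; rewrite kids.
  case: (boolP [exists c, (c != r) && (par c == v)]) => [/existsP[c /andP[cr /eqP pc]]|nokid].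
    by have [//|_] := IHv c cr pc; rewrite pc.
  have only x : e v x -> x = par v.
    case/(edge_par symE irrE root)=> -[// px xr].
    by case/existsP: nokid; exists x; rewrite xr px eqxx.
  by have [-> _] := code_leaf code1 only; have [-> _] := code_leaf code2 only.
apply/setP => v; have [->|/agree[]//] := eqVneq v r.
have [x erx] := tree_nbr tr T_gt1 r.
case: (edge_par symE irrE root erx) => -[px]; first by rewrite eqxx.
by case/agree; rewrite px.
Qed.

(** * Uniqueness of paths when every step crosses a bridge *)

Section UniquePaths.
Variables (I : eqType) (X : pred I) (R : rel I).
Hypothesis bridge : forall f a, X f -> X a -> R f a -> exists2 Q : pred I, Q f != Q a &
  forall h k, X h -> X k -> R h k -> Q h != Q k -> (h = f /\ k = a) \/ (h = a /\ k = f).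

(** If the first steps differ, the cut belonging to [f] and [a] is crossed once and for all by the
    first path and never by the second, so the paths cannot end at the same place. *)
Lemma bridges_uniq_path f s t : X f -> all X s -> all X t -> uniq (f :: s) -> uniq (f :: t) ->
  path R f s -> path R f t -> last f s = last f t -> s = t.
Proof.
elim: s f t => [|a s IHs] f [|b t] //= Xf.
- by move=> _ _ _ /andP[+ _] _ _ lst; rewrite lst mem_last.
- by move=> _ _ /andP[+ _] _ _ _ lst; rewrite -lst mem_last.
case/andP=> Xa Xs /andP[Xb Xt] /andP[fas Uas] /andP[fbt Ubt] /andP[Rfa pas] /andP[Rfb pbt] lst.
have [ab|ab] := eqVneq a b; first by rewrite -ab in fbt Ubt pbt lst *; rewrite (IHs a t).
have [Q Qfa Qcross] := bridge Xf Xa Rfa.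
have const c u : X c -> all X u -> f \notin c :: u -> path R c u -> Q (last c u) = Q c.
  elim: u c => //= d u IHu c Xc /andP[Xd Xu]; rewrite inE negb_or => /andP[fc fdu].
  case/andP=> Rcd pdu; rewrite IHu //; apply/eqP/contraT; rewrite eq_sym => Qcd.
  case: (Qcross c d) => // -[cE dE]; first by rewrite cE eqxx in fc.
  by rewrite dE inE eqxx in fdu.
have Qfb : Q f = Q b.
  apply/eqP/contraT => Qfb; case: (Qcross f b) => // -[E1 E2].
    by rewrite E2 eqxx in ab.
  by rewrite E2 inE eqxx in fbt.
by rewrite Qfb -(const b t) // -lst const ?eqxx in Qfa.
Qed.

End UniquePaths.

(** * Distances and walks *)

Section Distance.
Variables (T : finType) (e : rel T).

(** The bound on [k] is there because [dist] ranges only over lengths below [#|T|]. *)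
Lemma setdist_le (X Y : {set T}) x y k : x \in X -> y \in Y -> nwalk e k x y -> k < #|T| ->
  setdist e X Y <= k.
Proof.
move=> xX yY wk ltk; apply: leq_trans (bigmin_inf _ _ xX) _.
apply: leq_trans (bigmin_inf _ _ yY) _.
exact: (@bigmin_inf _ _ (fun k : 'I_#|T| => nwalk e k x y) val (Ordinal ltk)).
Qed.

Lemma setdist_walk (X Y : {set T}) : setdist e X Y < #|T| ->
  exists x y, [/\ x \in X, y \in Y & nwalk e (setdist e X Y) x y].
Proof.
move=> lt; have [x xX E1] := bigmin_attained lt; rewrite /setdist E1 in lt *.
have [y yY E2] := bigmin_attained lt; rewrite E2 in lt *.
by have [k wk E3] := bigmin_attained lt; rewrite /dist E3; exists x, y.
Qed.

Lemma nwalk3 x y : nwalk e 3 x y -> exists a b, [/\ e x a, e a b & e b y].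
Proof.
case/existsP=> a /andP[exa /existsP[b /andP[eab /existsP[c /andP[ebc /eqP cy]]]]].
by exists a, b; rewrite -cy.
Qed.

Lemma nwalk_cons k x z y : e x z -> nwalk e k z y -> nwalk e k.+1 x y.
Proof. by move=> exz wk; apply/existsP; exists z; rewrite exz. Qed.

End Distance.

Section Cond4.
Variables (T : finType) (e : rel T).
Hypotheses (tr : is_tree e) (T_gt5 : 5 < #|T|).
Let symE : symmetric e. Proof. by case: tr. Qed.
Let irrE : irreflexive e. Proof. by case: tr. Qed.

Lemma no_triangle x y z : e x y -> e y z -> ~~ e z x.
Proof.
move=> exy eyz; apply/negP => ezx.
have neq a b : e a b -> a != b by apply: contraTneq => ->; rewrite irrE.
case: tr => _ _ _ /(_ [:: x; y; z]) /=; rewrite !inE exy eyz ezx.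
rewrite [x == z]eq_sym (negPf (neq _ _ exy)) (negPf (neq _ _ eyz)) (negPf (neq _ _ ezx)).
by move/(_ isT isT).
Qed.

Lemma no_square x y z w : e x y -> e y z -> e z w -> x != z -> y != w -> ~~ e w x.
Proof.
move=> exy eyz ezw xz yw; apply/negP => ewx.
have neq a b : e a b -> a != b by apply: contraTneq => ->; rewrite irrE.
case: tr => _ _ _ /(_ [:: x; y; z; w]) /=; rewrite !inE exy eyz ezw ewx.
rewrite (negPf xz) (negPf yw) [x == w]eq_sym.
rewrite (negPf (neq _ _ exy)) (negPf (neq _ _ eyz)) (negPf (neq _ _ ezw)) (negPf (neq _ _ ewx)).
by move/(_ isT isT).
Qed.

Definition code_edges (B : {set T}) := [set f in edges e | f \subset B].

(** * From a code to condition 4 *)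

Section CodeToCond4.
Variable B : {set T}.
Hypothesis codeB : leafy_code e B.

(** Every vertex [v] is assigned to the matched edge [cl v] of its code neighbour. Distinct matched
    edges are at distance three exactly when a tree edge joins vertices assigned to them, so the
    graph of these pairs is connected and has only bridges. *)
Lemma code_cond4_F : cond4_F e (code_edges B).
Proof.
have [bn bnP] := code_nbr codeB; have [_ uniqB outB] := codeB.
have bnB v : bn v \in B by case: (bnP v).
have ebn v : e v (bn v) by case: (bnP v).
have bnE v w : w \in B -> e v w -> w = bn v by case: (bnP v) => _ _; apply.
have bn2 x : x \in B -> bn (bn x) = x by move=> xB; apply/esym/bnE; rewrite // symE.
set F := code_edges B.
have FP f : reflect (exists u v, [/\ e u v, u \in B, v \in B & f = [set u; v]]) (f \in F).
  rewrite inE; apply: (iffP andP) => [[/edgesP[u [v [euv ->]]]]|[u [v [euv uB vB ->]]]].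
    by rewrite subUset !sub1set => /andP[uB vB]; exists u, v.
  by rewrite edges_set2 // subUset !sub1set uB.
pose cl x := [set bn x; bn (bn x)].
have clF x : cl x \in F by apply/FP; exists (bn x), (bn (bn x)).
have FE f x : f \in F -> x \in f -> x \in B /\ f = cl x.
  case/FP=> u [v [euv uB vB ->]] /set2P[->|->]; split=> //.
    by rewrite /cl bn2 // -(bnE u v) // setUC.
  by rewrite /cl bn2 // -(bnE v u) // symE.
have cl_bn x : cl (bn x) = cl x by have [_ <-] := FE _ (bn x) (clF x) (set21 _ _).
have cl_id x : x \in B -> x \in cl x by move=> xB; rewrite -{1}(bn2 x) // set22.
have adj f g x y : f \in F -> g \in F -> x \in f -> y \in g -> e x y -> f = g.
  move=> fF gF /(FE f x fF)[xB ->] /(FE g y gF)[yB ->] exy.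
  by rewrite (bnE x y yB exy) cl_bn.
have near k f g x y : f \in F -> g \in F -> x \in f -> y \in g -> nwalk e k x y -> k < 3 -> f = g.
  move=> fF gF xf yg; have [xB fE] := FE f x fF xf; have [yB gE] := FE g y gF yg.
  case: k => [|[|[|//]]] /=; first by move/eqP=> xy; rewrite fE gE xy.
    by case/existsP=> z /andP[exz /eqP zy] _; apply: (adj f g x y); rewrite -?zy ?zy // -zy.
  case/existsP=> z /andP[exz /existsP[t /andP[ezt /eqP ty]]] _.
  by rewrite ty in ezt; rewrite fE gE; congr cl; apply: (uniqB z); rewrite // symE.
have lt_k k : k < 6 -> k < #|T| by move=> lk; apply: leq_trans lk T_gt5.
have far f g : f \in F -> g \in F -> f != g -> 3 <= setdist e f g.
  move=> fF gF; rewrite leqNgt; apply: contra => lt3.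
  have [x [y [xf yg wk]]] := setdist_walk (ltn_trans lt3 (lt_k 3 isT)).
  by apply/eqP; apply: near wk lt3.
have dist3 v w : e v w -> cl v != cl w -> setdist e (cl v) (cl w) = 3.
  move=> evw ne; apply/eqP; rewrite eqn_leq far // andbT.
  apply: (@setdist_le _ _ _ _ (bn v) (bn w)); rewrite ?set21 ?lt_k //.
  apply: (@nwalk_cons _ _ _ _ v); first by rewrite symE.
  by apply: nwalk_cons evw _; apply: nwalk_cons (ebn w) _; rewrite /= eqxx.
have dist3P f g : f \in F -> g \in F -> setdist e f g = 3 ->
    exists v w, [/\ e v w, v \notin B /\ w \notin B, cl v = f & cl w = g].
  move=> fF gF d3; have [|x [y [xf yg]]] := @setdist_walk _ e f g; first by rewrite d3 lt_k.
  have [xB fE] := FE f x fF xf; have [yB gE] := FE g y gF yg.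
  have fg : f != g.
    apply/eqP => E; have := @setdist_le _ e f f x x 0 xf xf (eqxx _) (lt_k 0 isT).
    by rewrite {2}E d3.
  rewrite d3 => /nwalk3[v [w [exv evw ewy]]]; exists v, w; split=> //.
  - split; apply/negP => inB.
      case/eqP: fg; apply: (near 2 f g v y) => //; last first.
        by apply: nwalk_cons evw _; apply: nwalk_cons ewy _; apply: eqxx.
      by rewrite fE (bnE x v inB exv) set21.
    case/eqP: fg; apply: (near 2 f g x w) => //; last first.
      by apply: nwalk_cons exv _; apply: nwalk_cons evw _; apply: eqxx.
    by rewrite gE (bnE y w) ?set21 // symE.
  - by rewrite fE -(cl_bn v) -(bnE v x) // symE.
  - by rewrite gE -(cl_bn w) -(bnE w y).
split.
- by apply/subsetP => f; rewrite inE => /andP[].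
- apply/subsetP => f; rewrite inE => /existsP[u /existsP[v /and3P[euv /cards1P[u0 lv] /eqP->]]].
  have only x : e v x -> x = u.
    move=> evx; have: x \in [set w | e v w] by rewrite inE.
    have: u \in [set w | e v w] by rewrite inE symE.
    by rewrite lv !inE => /eqP-> /eqP->.
  by have [vB uB] := code_leaf codeB only; apply/FP; exists u, v.
- move=> f fF; apply/eqP; rewrite eqn_leq; apply/andP; split; last first.
    apply/bigmin_leP; split=> [|g /setD1P[gf gF]]; first by rewrite ltnW // lt_k.
    by rewrite far // eq_sym.
  have [u0 [v0 [_ _ _ f0E]]] := FP f fF.
  have u0f : u0 \in f by rewrite f0E set21.
  have [|u [v [uf vf euv]]] := tree_exit tr u0f.
    apply: contraTneq T_gt5 => E; rewrite -cardsT -E f0E cards2; by case: (_ != _).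
  have [uB fE] := FE f u fF uf.
  have vB : v \notin B.
    apply: contra vf => vB; by rewrite fE (bnE u v vB euv) set21.
  have [w wB evw] := outB v vB.
  have clv : cl v = f by rewrite fE -(cl_bn v) -(bnE v u) // symE.
  (* Were [w] assigned to [f] as well, [u], [v] and [w] would lie on a triangle or a square. *)
  have ne : cl w != f.
    apply/eqP => E; have bwf : bn w \in f by rewrite -E set21.
    have uw : u != w by apply: contraNneq wB => <-.
    move: bwf; rewrite fE /cl bn2 // => /set2P[bw|bw].
      have := @no_square u v w (bn w) euv evw (ebn w) uw _.
      by rewrite bw [e _ u]symE ebn => /(_ _)/negP; case=> //; apply: contraNneq vB => ->.
    by have := no_triangle euv evw; rewrite -bw ebn.
  apply: leq_trans (bigmin_inf _ _ (i := cl w) _) _; first by rewrite in_setD1 ne clF.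
  by rewrite -clv dist3 // clv eq_sym.
- move=> f g fF gF fg; pose H := [rel a b | [&& a \in F, b \in F & setdist e a b == 3]].
  have clH x y : e x y -> connect H (cl x) (cl y).
    move=> exy; have [->|ne] := eqVneq (cl x) (cl y); first exact: connect0.
    by apply: connect1; rewrite /= !clF dist3.
  have conH x y : connect H (cl x) (cl y).
    case: tr => _ _ /(_ x y)/connectP[p pth ->] _.
    elim: p x pth => [|z p IHp] x /=; first by move=> _; apply: connect0.
    by case/andP=> /clH/connect_trans + /IHp; apply.
  have [u [u' [_ _ _ fE]]] := FP f fF; have [v [v' [_ _ _ gE]]] := FP g gF.
  have [uf vg] : u \in f /\ v \in g by rewrite fE gE !set21.
  have /connectP[p0 pth0] : connect H f g.
    by have [_ ->] := FE f u fF uf; have [_ ->] := FE g v gF vg.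
  case/shortenP: pth0 => p pth Up _ lst {p0}.
  have [allp pathp] : all (fun h => h \in F) p /\ path (fun a b => setdist e a b == 3) f p.
    elim: p f pth {fF fg fE uf Up lst} => //= a p IHp f /andP[/and3P[fF aF d3] /IHp[-> ->]].
    by rewrite aF d3.
  exists p; split=> // q [allq Uq pathq lastq].
  apply: (@bridges_uniq_path _ (mem F) (fun a b => setdist e a b == 3) _ f) => //;
    last by rewrite lastq.
  move=> a b /= aF bF /eqP d3; have [v1 [w1 [evw1 [v1B w1B] clv clw]]] := dist3P a b aF bF d3.
  have [par [dep root]] := tree_rooted tr u.
  have [l [lr lE]] : exists l, l != u /\ [set v1; w1] = [set l; par l].
    case: (edge_par symE irrE root evw1) => -[pE nr]; first by exists v1; rewrite pE.
    by exists w1; rewrite pE setUC.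
  have cross x y : e x y -> desc par l x != desc par l y -> [set x; y] = [set v1; w1].
    move=> exy; rewrite lE; 
    case: (boolP (desc par l x)) => [dx|ndx]; case: (boolP (desc par l y)) => [dy|ndy] // _.
      by have [-> ->] := desc_cross symE irrE root exy dx ndy.
    by rewrite symE in exy; have [-> ->] := desc_cross symE irrE root exy dy ndx; rewrite setUC.
  have crossB x y : e x y -> y \in B -> desc par l x = desc par l y.
    move=> exy yB; apply/eqP/contraT => /(cross x y exy)/set2_mem[][_ yE];
      by move: yB; rewrite yE ?(negPf v1B) ?(negPf w1B).
  (* The cut is given by the tree edge [v1w1]. Both its ends are outside [B], so no edge with an end
     in [B] crosses it, and all vertices assigned to [h] are on one side. *)
  pose Q (h : {set T}) := [exists x in h, desc par l x].
  have Qcl x : Q (cl x) = desc par l x.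
    rewrite (crossB x (bn x)) //; apply/exists_inP/idP => [[y /set2P[->//|->]]|d].
      by rewrite -(crossB (bn x)).
    by exists (bn x); rewrite ?set21.
  exists Q.
    have := desc_parN root lr; have := connect0 (frel par) l; rewrite -/(desc par l l).
    rewrite -clv -clw !Qcl; case/set2_mem: lE => -[-> ->] -> /negPf-> //.
  move=> h k hF kF /eqP d3' ; have [v2 [w2 [evw2 _ <- <-]]] := dist3P h k hF kF d3'.
  rewrite !Qcl => /(cross _ _ evw2)/set2_mem[][-> ->]; rewrite clv clw; by [left | right].
Qed.

End CodeToCond4.

(** Distance at least three between distinct members makes code neighbours unique, and pendant edges
    cover the leaves. A vertex [v] without a neighbour in [B] would separate [F]: different branches
    at [v] contain members of [F], but no step of distance three passes through [v]. *)
Lemma cond4_F_code F : cond4_F e F -> leafy_code e (cover F) /\ F = code_edges (cover F).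
Proof.
move=> [/subsetP sFE /subsetP pendF distF pathF]; set B := cover F.
have T_gt1 : 1 < #|T| by apply: leq_trans T_gt5.
have nbr := tree_nbr tr T_gt1.
have lt_k k : k < 6 -> k < #|T| by move=> lk; apply: leq_trans lk T_gt5.
have BP x : reflect (exists2 f, f \in F & x \in f) (x \in B) by apply: bigcupP.
have pairF f x y : f \in F -> x \in f -> y \in f -> x != y -> e x y /\ f = [set x; y].
  move/sFE/edgesP=> [u [v [euv ->]]] /set2P[->|->] /set2P[->|->]; rewrite ?eqxx // => _.
  by rewrite symE setUC.
have otherF f x : f \in F -> x \in f -> exists y, [/\ e x y, y \in f & f = [set x; y]].
  move=> /sFE/edgesP[u [v [euv ->]]] /set2P[->|->]; first by exists v; rewrite set22.
  by exists u; rewrite symE set21 setUC.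
have near k f g x y : f \in F -> g \in F -> x \in f -> y \in g -> nwalk e k x y -> k < 3 -> f = g.
  move=> fF gF xf yg wk lk; apply/eqP/contraT => fg.
  have := setdist_le xf yg wk (lt_k k (leq_trans lk (isT : 3 <= 6))); rewrite leqNgt.
  rewrite (leq_trans lk) // -(distF f fF); apply: bigmin_inf.
  by rewrite in_setD1 eq_sym fg.
have uniqB v w w' : w \in B -> w' \in B -> e v w -> e v w' -> w = w'.
  move=> /BP[f fF wf] /BP[g gF wg] evw evw'; apply/eqP/contraT => ww'.
  have fg : f = g.
    apply: (near 2 f g w w') => //; apply: (@nwalk_cons _ _ _ _ v); first by rewrite symE.
    by apply: nwalk_cons evw' _; rewrite /= eqxx.
  rewrite -fg in wg; have [eww' _] := pairF f w w' fF wf wg ww'.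
  by have := no_triangle evw eww'; rewrite symE evw'.
have leafB v : (forall x y, e v x -> e v y -> x = y) -> v \in B.
  move=> only; have [u evu] := nbr v; apply/BP; exists [set u; v]; last exact: set22.
  apply: pendF; rewrite inE; apply/existsP; exists u; apply/existsP; exists v.
  rewrite symE evu eqxx andbT /=; apply/cards1P; exists u; apply/setP => x; rewrite !inE.
  by apply/idP/eqP => [/only|->]; first by apply.
have codeF : F = code_edges B.
  apply/setP => f; rewrite inE; apply/idP/andP => [fF|[/edgesP[u [v [euv ->]]]]].
    split; [exact: sFE | apply/subsetP => x xf; apply/BP; by exists f].
  rewrite subUset !sub1set => /andP[/BP[f1 f1F uf1] /BP[f2 f2F vf2]].
  have E : f1 = f2.
    by apply: (near 1 f1 f2 u v) => //; apply: nwalk_cons euv _; rewrite /= eqxx.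
  have uv : u != v by apply: contraTneq euv => ->; rewrite irrE.
  by rewrite -E in vf2; have [_ <-] := pairF f1 u v f1F uf1 vf2 uv.
split=> //; split=> // [v|v vB]; last first.
  apply/exists_inP; apply/contraT => /exists_inP all_in.
  have inB x : e v x -> x \in B by move=> evx; apply/contraT => xB; case: all_in; exists x.
  by case/negP: vB; apply: leafB => x y evx evy; apply: (uniqB v); rewrite ?inB.
apply/exists_inP; apply/contraT => /exists_inP none.
have noB x : e v x -> x \notin B by move=> evx; apply/negP => xB; case: none; exists x.
have vB : v \notin B.
  apply/negP => /BP[f fF /(otherF f v fF)[y [evy yf _]]].
  by case: none; exists y => //; apply/BP; exists f.
have [par [dep root]] := tree_rooted tr v; have [par_v _ _ _] := root.
(* A deepest vertex of a set closed under children is a leaf, hence covered by a pendant edge. *)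
have leaf_below (X : {set T}) z0 : z0 \in X -> v \notin X ->
    (forall c, c != v -> par c \in X -> c \in X) -> exists2 z, z \in X & z \in B.
  move=> z0X vX down; case: (@arg_maxnP _ z0 (fun x => x \in X) dep z0X) => z zX maxz.
  exists z => //; suff only x : e z x -> x = par z by apply: leafB => x y /only-> /only->.
  case/(edge_par symE irrE root)=> -[// px xv].
  have := maxz x (down x xv _); rewrite px => /(_ zX).
  by rewrite (dep_par root xv) px /= ltnn.
have [u evu] := nbr v.
have [pu uv] : par u = v /\ u != v.
  apply: (child_par symE irrE root evu); rewrite par_v.
  by apply: contraTneq evu => <-; rewrite irrE.
have [w [evw wu]] : exists w, e v w /\ w != u.
  have [/existsP[w /andP[]]|no] := boolP [exists w, e v w && (w != u)]; first by exists w.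
  have to_u x : e v x -> x = u.
    by move=> evx; apply/eqP/contraT => xu; case/existsP: no; exists x; rewrite evx.
  by case/negP: vB; apply: leafB => x y /to_u-> /to_u->.
have [pw wv] : par w = v /\ w != v.
  apply: (child_par symE irrE root evw); rewrite par_v.
  by apply: contraTneq evw => <-; rewrite irrE.
have nuv : ~~ desc par u v by apply/negP => /(desc_root root) E; rewrite E eqxx in uv.
have [|||z1 d1 z1B] := leaf_below [set z | desc par u z] u.
- by rewrite inE; apply: connect0.
- by rewrite inE.
- by move=> c _; rewrite !inE; apply: desc_par.
have [|||z2 d2 z2B] := leaf_below [set z | (z != v) && ~~ desc par u z] w.
- by rewrite inE wv; apply/negP => /descP[/eqP|]; [rewrite (negPf wu) | rewrite pw (negPf nuv)].
- by rewrite inE eqxx.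
- move=> c cv; rewrite !inE cv => /andP[pcv nd]; apply/negP => /descP[cu|]; last exact/negP.
  by rewrite cu pu eqxx in pcv.
rewrite !inE in d1 d2; case/andP: d2 => _ d2.
have stay x y : e x y -> x != v -> y != v -> desc par u x -> desc par u y.
  move=> exy xv yv dx; apply/contraT => dy.
  by have [_ yE] := desc_cross symE irrE root exy dx dy; rewrite yE pu eqxx in yv.
have Bv x : x \in B -> x != v by apply: contraTneq => ->.
have inF f x : f \in F -> x \in f -> x \in B by move=> fF xf; apply/BP; exists f.
have stayF f x y : f \in F -> x \in f -> y \in f -> desc par u x -> desc par u y.
  move=> fF xf yf; have [->//|xy] := eqVneq x y; have [exy _] := pairF f x y fF xf yf xy.
  by apply: stay => //; apply/Bv/(inF f).
(* The two inner vertices of a walk of length three between [f] and [g] have neighbours in [B], so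
   neither is [v]. *)
have jump f g x y : f \in F -> g \in F -> setdist e f g = 3 -> x \in f -> y \in g ->
    desc par u x -> desc par u y.
  move=> fF gF d3 xf yg dx; have [|x' [y' [xf' yg' w3]]] := @setdist_walk _ e f g.
    by rewrite d3 lt_k.
  move: w3; rewrite d3 => /nwalk3[a [b [ea eab eb]]].
  have [xB yB] : x' \in B /\ y' \in B by split; [apply: inF fF _ | apply: inF gF _].
  have av : a != v by apply/eqP => av; have := noB x'; rewrite -av symE ea xB => /(_ isT).
  have bv : b != v by apply/eqP => bv; have := noB y'; rewrite -bv eb yB => /(_ isT).
  apply: (stayF g y' y gF yg' yg); apply: (stay b y' eb bv (Bv _ yB)).
  by apply: (stay a b eab av bv); apply: (stay x' a ea (Bv _ xB) av); apply: (stayF f x).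
have [f1 f1F zf1] := BP z1 z1B; have [f2 f2F zf2] := BP z2 z2B.
have f12 : f1 != f2.
  by apply: contraNneq d2 => E; apply: (stayF f1 z1) => //; rewrite E.
have [s [[allF _ pths lst] _]] := pathF f1 f2 f1F f2F f12.
case/negP: d2; rewrite -lst in zf2; elim: s f1 z1 f1F zf1 d1 allF pths zf2 {f12 z1B lst}.
  by move=> f z fF zf dz _ _ /= zf2; apply: (stayF f z).
move=> g s IHs f z fF zf dz /= /andP[gF sF] /andP[/eqP d3 pths].
have [a ag] : exists a, a \in g by have /edgesP[a [b [_ ->]]] := sFE g gF; exists a; rewrite set21.
by apply: (IHs g a) => //; apply: (jump f g z).
Qed.

Lemma code_cond4 B : leafy_code e B -> cond4 e.
Proof.
move=> codeB; exists (code_edges B); split; first exact: code_cond4_F.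
move=> F /cond4_F_code[codeF ->]; congr code_edges.
by apply: code_unique tr _ codeB codeF; apply: leq_trans T_gt5.
Qed.

End Cond4.

(** * The families T and O *)

(** The statuses [B] and [C] both mark code vertices, so this bit is all that is tracked. *)
Definition isA (s : status) : bool := if s is SA then true else false.

(** The common effect of the first operations of both families, whose results differ only in the
    status of the last new vertex. *)
Definition op1_ext n (r : rel nat) (l : nat -> bool) z (r' : rel nat) (l' : nat -> bool) :=
  [/\ r' =2 addE (addE (addE r z n) n n.+1) n.+1 n.+2, forall i, i < n -> l' i = l i,
      l' n, ~~ l' n.+1 & ~~ l' n.+2].

(* The new path is [p q s t] with [p] attached to [x]; families T and O number it in
   opposite directions. *)
Definition op2_ext n (r : rel nat) (l : nat -> bool) x (r' : rel nat) (l' : nat -> bool) :=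
  exists p q s t, [/\ perm_eq [:: p; q; s; t] (iota n 4),
      r' =2 addE (addE (addE (addE r x p) p q) q s) s t, forall i, i < n -> l' i = l i,
      l' p /\ l' q & ~~ l' s /\ ~~ l' t].

(** The analogue of [leafy_code] for the vertices below [n], with [l] marking those outside the
    code. *)
Definition nat_code n (r : rel nat) (l : nat -> bool) :=
  [/\ forall i j, r i j -> i < n /\ j < n,
      forall v, v < n -> exists w, [/\ w < n, ~~ l w & r v w],
      forall v w w', ~~ l w -> ~~ l w' -> r v w -> r v w' -> w = w' &
      forall v, v < n -> l v -> exists w, [/\ w < n, l w & r v w]].

(** * The operations preserve codes *)

Lemma addE_inv (r : rel nat) x y i j :
  addE r x y i j -> r i j \/ (i = x /\ j = y) \/ (i = y /\ j = x).
Proof. by case/orP=> [/orP[|/andP[/eqP-> /eqP->]]|/andP[/eqP-> /eqP->]]; tauto. Qed.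

Lemma nat_code_P6 l : (forall i, i < 6 -> l i = (i == 2) || (i == 3)) -> nat_code 6 adjP6 l.
Proof.
move=> lE; have bnd i j : adjP6 i j -> i < 6 /\ j < 6 by case/and3P.
split=> //.
- move=> v lv; exists (nth 0 [:: 1; 0; 1; 4; 5; 4] v).
  by move: v lv => [|[|[|[|[|[|//]]]]]] _; rewrite lE.
- move=> v w w' lw lw' /[dup]/bnd[lv ltw] rw /[dup]/bnd[_ ltw'] rw'.
  rewrite !lE // in lw lw'.
  by move: v w w' lv ltw ltw' lw lw' rw rw' => [|[|[|[|[|[|//]]]]]] [|[|[|[|[|[|//]]]]]]
    [|[|[|[|[|[|//]]]]]].
- move=> v lv; rewrite lE // => /orP[]/eqP->; [exists 3 | exists 2]; by rewrite lE.
Qed.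

(** Among the old vertices only [z] gains a neighbour, and that one is outside the code. On the new
    path the last two vertices are matched and the middle one dominates the first. *)
Lemma nat_code_op1 n r l z r' l' : nat_code n r l -> z < n -> l z ->
  op1_ext n r l z r' l' -> nat_code (n + 3) r' l'.
Proof.
move=> [bnd dom uniq_r out] ltz lz [r'E l'E ln ln1 ln2].
have inv i j : r' i j -> r i j \/ (i = z /\ j = n) \/ (i = n /\ j = z) \/
    (i = n /\ j = n.+1) \/ (i = n.+1 /\ j = n) \/ (i = n.+1 /\ j = n.+2) \/
    (i = n.+2 /\ j = n.+1).
  by rewrite r'E => /addE_inv[/addE_inv[/addE_inv|]|]; tauto.
have old i j : r i j -> r' i j by move=> rij; rewrite r'E /addE rij.
have cases v : v < n + 3 -> v < n \/ v = n \/ v = n.+1 \/ v = n.+2 by clear; lia.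
have [e1 e2 e3 e4] : [/\ r' n n.+1, r' n.+1 n.+2, r' n.+2 n.+1 & r' n z].
  by rewrite !r'E /addE !eqxx !orbT.
have lt3 v : v < n -> v < n + 3 by clear; lia.
have [lt_n lt_n1 lt_n2] : [/\ n < n + 3, n.+1 < n + 3 & n.+2 < n + 3] by clear; split; lia.
have old_new v : v < n -> [/\ v <> n, v <> n.+1 & v <> n.+2] by clear; split; lia.
split.
- move=> i j /inv[/bnd[/lt3 ? /lt3 ?] //|]; have := lt3 z ltz.
  by intuition (subst; auto).
- move=> v /cases[/[dup] ltv /dom[w [ltw lw rw]]|[->|[->|->]]].
  + by exists w; rewrite l'E // old // lt3.
  + by exists n.+1.
  + by exists n.+2.
  + by exists n.+1.
- have into v w : ~~ l' w -> r' v w -> (v < n /\ ~~ l w /\ r v w) \/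
      (v = n /\ w = n.+1) \/ (v = n.+1 /\ w = n.+2) \/ (v = n.+2 /\ w = n.+1).
    move=> lw /inv[/[dup] rvw /bnd[ltv ltw]|]; first by rewrite l'E // in lw; left.
    have wz : w <> z by move=> wE; rewrite wE l'E // lz in lw.
    have wn : w <> n by move=> wE; rewrite wE ln in lw.
    by tauto.
  move=> v w w' lw lw' /(into v w lw) H /(into v w' lw') H'.
  case: H => [[/old_new[? ? ?] [lw1 rw]]|H]; case: H' => [[/old_new[? ? ?] [lw1' rw']]|H'].
  + exact: uniq_r rw rw'.
  + by tauto.
  + by tauto.
  + have [? ? ?] : [/\ n <> n.+1, n <> n.+2 & n.+1 <> n.+2] by clear; split; lia.
    by intuition congruence.
- move=> v /cases[ltv|[->|[vE|vE]]]; rewrite ?vE ?(negPf ln1) ?(negPf ln2) //.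
    rewrite l'E // => /(out v ltv)[w [ltw lw rw]].
    by exists w; rewrite l'E // old // lt3.
  by move=> _; exists z; rewrite l'E // lt3.
Qed.

(** The code neighbour of [p] is [x], that of [q] is [s], and [s] and [t] are matched; [p] and [q]
    are each other's neighbours outside the code. *)
Lemma nat_code_op2 n r l x r' l' : nat_code n r l -> x < n -> ~~ l x ->
  op2_ext n r l x r' l' -> nat_code (n + 4) r' l'.
Proof.
move=> [bnd dom uniq_r out] ltx lx [p [q [s [t [pqst r'E l'E [lp lq] [ls lt]]]]]].
have memE i : (i \in [:: p; q; s; t]) = (n <= i < n + 4).
  by rewrite (perm_mem pqst) mem_iota.
have Upqst : uniq [:: p; q; s; t] by rewrite (perm_uniq pqst) iota_uniq.
have [pq [ps [pt [qs [qt st]]]]] : p <> q /\ p <> s /\ p <> t /\ q <> s /\ q <> t /\ s <> t.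
  by move: Upqst; rewrite /= !inE; clear; lia.
have inv i j : r' i j -> r i j \/ (i = x /\ j = p) \/ (i = p /\ j = x) \/
    (i = p /\ j = q) \/ (i = q /\ j = p) \/ (i = q /\ j = s) \/ (i = s /\ j = q) \/
    (i = s /\ j = t) \/ (i = t /\ j = s).
  by rewrite r'E => /addE_inv[/addE_inv[/addE_inv[/addE_inv|]|]|]; tauto.
have old i j : r i j -> r' i j by move=> rij; rewrite r'E /addE rij.
have cases v : v < n + 4 -> v < n \/ v = p \/ v = q \/ v = s \/ v = t.
  by move=> ltv; have := memE v; rewrite ltv !inE; clear; lia.
have [e1 e2 e3] : [/\ r' p x, r' q s & r' p q] by rewrite !r'E /addE !eqxx !orbT.
have [e4 e5 e6] : [/\ r' t s, r' s t & r' q p] by rewrite !r'E /addE !eqxx !orbT.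
have lt4 v : v < n -> v < n + 4 by clear; lia.
have new i : i \in [:: p; q; s; t] -> i < n + 4 /\ forall v, v < n -> v <> i.
  by rewrite memE => /andP[le_n lt_4]; split=> // v; move: le_n; clear; lia.
have [[ltp ne_p] [ltq ne_q]] : (p < n + 4 /\ forall v, v < n -> v <> p) /\
  (q < n + 4 /\ forall v, v < n -> v <> q) by split; apply: new; rewrite !inE eqxx ?orbT.
have [[lts ne_s] [ltt ne_t]] : (s < n + 4 /\ forall v, v < n -> v <> s) /\
  (t < n + 4 /\ forall v, v < n -> v <> t) by split; apply: new; rewrite !inE eqxx ?orbT.
split.
- move=> i j /inv[/bnd[/lt4 ? /lt4 ?] //|]; have := lt4 x ltx.
  by intuition (subst; auto).
- move=> v /cases[/[dup] ltv /dom[w [ltw lw rw]]|[->|[->|[->|->]]]].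
  + by exists w; rewrite l'E // old // lt4.
  + by exists x; rewrite l'E // lt4.
  + by exists s.
  + by exists t.
  + by exists s.
- have into v w : ~~ l' w -> r' v w -> (v < n /\ ~~ l w /\ r v w) \/
      (v = p /\ w = x) \/ (v = q /\ w = s) \/ (v = s /\ w = t) \/ (v = t /\ w = s).
    move=> lw /inv[/[dup] rvw /bnd[ltv ltw]|]; first by rewrite l'E // in lw; left.
    have wp : w <> p by move=> wE; rewrite wE lp in lw.
    have wq : w <> q by move=> wE; rewrite wE lq in lw.
    by tauto.
  have old_new v : v < n -> [/\ v <> p, v <> q, v <> s & v <> t].
    by move=> ltv; split; [apply: ne_p | apply: ne_q | apply: ne_s | apply: ne_t].
  move=> v w w' lw lw' /(into v w lw) H /(into v w' lw') H'.
  case: H => [[/old_new[? ? ? ?] [lw1 rw]]|H]; case: H' => [[/old_new[? ? ? ?] [lw1' rw']]|H'].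
  + exact: uniq_r rw rw'.
  + by tauto.
  + by tauto.
  + by intuition congruence.
- move=> v /cases[ltv|[->|[->|[vE|vE]]]]; rewrite ?vE ?(negPf ls) ?(negPf lt) // => lv.
  + rewrite l'E // in lv; have [w [ltw lw rw]] := out v ltv lv.
    by exists w; rewrite l'E // old // lt4.
  + by exists q.
  + by exists p.
Qed.

Arguments upd : simpl never.

Lemma upd_lt lab i j s : i < j -> upd lab j s i = lab i.
Proof. by rewrite /upd => /ltn_eqF->. Qed.

Lemma op1_extP n r lab z s3 : ~~ isA s3 ->
  op1_ext n r (isA \o lab) z (addE (addE (addE r z n) n n.+1) n.+1 n.+2)
    (isA \o upd (upd (upd lab n SA) n.+1 SB) n.+2 s3).
Proof.
move=> nA; split=> //=.
- by move=> i lti /=; rewrite !upd_lt //; do ?apply: leqW.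
- by rewrite /upd; do ?case: eqP => ? //; lia.
- by rewrite /upd; do ?case: eqP => ? //; lia.
- by rewrite /upd eqxx.
Qed.

Lemma famT_op2_ext n r lab x :
  op2_ext n r (isA \o lab) x (addE (addE (addE (addE r x n) n n.+1) n.+1 n.+2) n.+2 n.+3)
    (isA \o upd (upd (upd (upd lab n SA) n.+1 SA) n.+2 SB) n.+3 SC).
Proof.
exists n, n.+1, n.+2, n.+3; split=> //.
- by move=> i lti /=; rewrite !upd_lt //; do ?apply: leqW.
- by split; rewrite /= /upd; do ?case: eqP => ? //; lia.
- by split; rewrite /= /upd; do ?case: eqP => ? //; lia.
Qed.

Lemma famO_op2_ext n r lab x :
  op2_ext n r (isA \o lab) x (addE (addE (addE (addE r n n.+1) n.+1 n.+2) n.+2 n.+3) n.+3 x)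
    (isA \o upd (upd (upd (upd lab n SB) n.+1 SB) n.+2 SA) n.+3 SA).
Proof.
exists n.+3, n.+2, n.+1, n; split=> //.
- by rewrite -[X in perm_eq X]/(rev (iota n 4)) perm_rev.
- move=> i j; rewrite /addE -!orbA; apply/idP/idP; do ![case/orP]; by move=> ->; rewrite ?orbT.
- by move=> i lti /=; rewrite !upd_lt //; do ?apply: leqW.
- by split; rewrite /= /upd; do ?case: eqP => ? //; lia.
- by split; rewrite /= /upd; do ?case: eqP => ? //; lia.
Qed.

Lemma famT_nat_code n r lab : famT n r lab -> nat_code n r (isA \o lab).
Proof.
elim=> [|m s lb y _ IH lty ly|m s lb y _ IH lty ly].
- by apply: nat_code_P6; case=> [|[|[|[|[|[|]]]]]].
- by apply: nat_code_op1 IH lty _ (op1_extP _ _ _ _ _); rewrite //= ly.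
- by apply: nat_code_op2 IH lty _ (famT_op2_ext _ _ _ _); case: ly => /= ->.
Qed.

Lemma famO_nat_code n r lab : famO n r lab -> nat_code n r (isA \o lab).
Proof.
elim=> [|m s lb x y z _ IH ltx lty ltz _ _ _ _ _ lz|m s lb x y _ IH ltx lty _ lx _].
- by apply: nat_code_P6; case=> [|[|[|[|[|[|]]]]]].
- by apply: nat_code_op1 IH ltz _ (op1_extP _ _ _ _ _); rewrite //= lz.
- by apply: nat_code_op2 IH ltx _ (famO_op2_ext _ _ _ _); rewrite /= lx.
Qed.

(** Lets a status other than [A] be read as [SB], which the operations of this family demand. *)
Lemma famO_neq_SC n r lab : famO n r lab -> forall i, lab i <> SC.
Proof.
elim=> [i|m s lb x y z _ IH _ _ _ _ _ _ _ _ _ i|m s lb x y _ IH _ _ _ _ _ i].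
- by rewrite /labO6; case: ifP.
- by rewrite /upd; do !case: ifP.
- by rewrite /upd; do !case: ifP.
Qed.

Lemma nat_code_leafy (T : finType) (e : rel T) n (r : rel nat) l (f : T -> 'I_n) :
  bijective f -> (forall u v, e u v = r (f u) (f v)) -> nat_code n r l ->
  exists B, leafy_code e B.
Proof.
move=> [g fK gK] eE [_ dom uniq_r out]; exists [set x | ~~ l (f x)].
have back w (ltw : w < n) : exists x, f x = w :> nat by exists (g (Ordinal ltw)); rewrite gK.
split=> [v|v w w'|v]; last 1 first.
- rewrite inE negbK => lv; have [w [ltw lw rw]] := out (f v) (ltn_ord _) lv.
  by have [x fx] := back w ltw; exists x; rewrite ?inE ?negbK ?eE fx.
- have [w [ltw lw rw]] := dom (f v) (ltn_ord _).
  by have [x fx] := back w ltw; exists x; rewrite ?inE ?eE fx.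
- rewrite !inE !eE => lw lw' rw rw'; apply: (can_inj fK); apply: val_inj.
  exact: uniq_r rw rw'.
Qed.

(** * Growing a tree with a code by the operations *)

Section Growth.
Variables (T : finType) (e : rel T) (B : {set T}).
Hypotheses (tr : is_tree e) (T_gt5 : 5 < #|T|) (codeB : leafy_code e B).
Let symE : symmetric e. Proof. by case: tr. Qed.
Let irrE : irreflexive e. Proof. by case: tr. Qed.

Section Embedding.
Variables (r0 : T) (par : T -> T) (dep : T -> nat).
Hypothesis root : rooted e r0 par dep.

(** A stage of the construction, with [idx] numbering the part [U] built so far. The bound [N] is
    separate from [#|U|], so that a new path can be added vertex by vertex with its final labels
    already in place. *)
Definition embedded (U : {set T}) (idx : T -> nat) (r : rel nat) (l : nat -> bool) N :=
  [/\ (forall x, x \in U -> par x \in U), {in U &, injective idx},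
      (forall x y, x \in U -> y \in U -> r (idx x) (idx y) = e x y),
      (forall i j, r i j -> (exists2 x, x \in U & idx x = i) /\ (exists2 y, y \in U & idx y = j)) &
      (forall x, x \in U -> idx x < N /\ l (idx x) = (x \notin B))].

Lemma embedded_weaken U idx r l N r' l' N' : embedded U idx r l N -> r =2 r' ->
  (forall i, i < N -> l' i = l i) -> N <= N' -> embedded U idx r' l' N'.
Proof.
move=> [upU inj eU rU lU] rr' ll' NN'; split=> // [x y xU yU|i j|x xU].
- by rewrite -rr' eU.
- by rewrite -rr'; apply: rU.
- by have [lt lE] := lU x xU; rewrite ll' // (leq_trans lt).
Qed.

(** As [U] is closed under parents, [u] is the only neighbour of [w] in [U], so one [addE] records
    all new adjacencies. The last clause prepares the addition of a child of [w]. *)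
Lemma embedded_add U idx r l N u w m : embedded U idx r l N ->
  u \in U -> w \notin U -> e u w -> par w = u ->
  (forall x, x \in U -> idx x != m) -> m < N -> l m = (w \notin B) ->
  exists idx', [/\ embedded (w |: U) idx' (addE r (idx u) m) l N, idx' w = m,
    forall x, x \in U -> idx' x = idx x &
    forall y, e w y -> par y = w -> y \notin w |: U].
Proof.
move=> [upU inj eU rU lU] uU wU euw pw fresh ltm lm.
exists (fun x => if x == w then m else idx x).
have neq_w x : x \in U -> (x == w) = false by move=> xU; apply: contraNF wU => /eqP<-.
have r_mr i : r m i = false.
  by apply/negP => /rU[[x xU xm]]; have := fresh x xU; rewrite xm eqxx.
have r_ml i : r i m = false.
  by apply/negP => /rU[_ [x xU xm]]; have := fresh x xU; rewrite xm eqxx.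
have e_w x : x \in U -> e w x = (x == u).
  move=> xU; apply/idP/eqP => [ewx|->]; last by rewrite symE.
  case: (edge_par symE irrE root ewx) => -[px _]; first by rewrite -px.
  by have := upU x xU; rewrite px (negPf wU).
have idx_eq x : x \in U -> (idx x == idx u) = (x == u).
  by move=> xU; apply/eqP/eqP => [/inj->|->].
split; rewrite ?eqxx //; last 2 first.
- by move=> x xU; rewrite neq_w.
- move=> y ewy py; rewrite !inE negb_or; apply/andP; split.
    by apply: contraTneq ewy => ->; rewrite irrE.
  by apply: contra wU => /upU; rewrite py.
split.
- by move=> x /setU1P[->|xU]; rewrite setU1r // ?pw // upU.
- move=> x y /setU1P[->|xU] /setU1P[->|yU]; rewrite ?eqxx ?neq_w // => E.
  + by have := fresh y yU; rewrite -E eqxx.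
  + by have := fresh x xU; rewrite E eqxx.
  + exact: inj.
- have um := negPf (fresh u uU).
  move=> x y /setU1P[->|xU] /setU1P[->|yU]; rewrite ?eqxx ?neq_w // /addE.
  + by rewrite r_mr irrE eqxx [m == _]eq_sym um.
  + by rewrite r_mr eqxx [m == _]eq_sym um /= idx_eq // e_w.
  + by rewrite r_ml eqxx [m == _]eq_sym um andbF andbT orbF /= idx_eq // symE e_w.
  + by rewrite eU // !(negPf (fresh _ _)) // !andbF !orbF.
- have imU x : x \in U -> exists2 y, y \in w |: U & (if y == w then m else idx y) = idx x.
    by move=> xU; exists x; rewrite ?setU1r // neq_w.
  have imw : exists2 y, y \in w |: U & (if y == w then m else idx y) = m.
    by exists w; rewrite ?setU11 // eqxx.
  move=> i j /addE_inv[/rU[[x xU <-] [y yU <-]]|[[-> ->]|[-> ->]]].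
  + by split; apply: imU.
  + by split; [apply: imU | apply: imw].
  + by split; [apply: imw | apply: imU].
- by move=> x /setU1P[->|xU]; rewrite ?eqxx ?neq_w //; apply: lU.
Qed.

Fixpoint add_path (r : rel nat) i ms : rel nat :=
  if ms is m :: ms' then add_path (addE r i m) m ms' else r.

(** Only the first vertex of [ws] is assumed to be outside [U]: by closure under parents the later
    ones are outside as well. *)
Lemma embedded_path l N ws ms U idx r u : embedded U idx r l N -> u \in U ->
  path (fun x y => e x y && (par y == x)) u ws -> ~~ has (mem U) (take 1 ws) ->
  all2 (fun w m => l m == (w \notin B)) ws ms -> uniq ms -> all (gtn N) ms ->
  (forall x, x \in U -> idx x \notin ms) ->
  (exists idx', embedded (U :|: [set x in ws]) idx' (add_path r (idx u) ms) l N)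
  /\ #|U :|: [set x in ws]| = #|U| + size ws.
Proof.
elim: ws ms U idx r u => [|w ws IHws] [|m ms] U idx r u //= emb uU.
  by move=> *; rewrite set_nil setU0 addn0; split=> //; exists idx.
rewrite take0 orbF.
case/andP=> /andP[euw /eqP pw] pws wU /andP[/eqP lm lms] /andP[mms Ums] /andP[ltm ltms] fresh.
have fresh_m x : x \in U -> idx x != m by move/fresh; rewrite inE negb_or => /andP[].
have [idx' [emb' idxw idxU next]] := embedded_add emb uU wU euw pw fresh_m ltm lm.
have [||[idx2 emb2] card2] := IHws ms _ _ _ w emb' (setU11 _ _) pws _ lms Ums ltms.
- case: ws {IHws lms} pws => //= y ws /andP[/andP[ewy /eqP py] _].
  by rewrite take0 orbF next.
- move=> x /setU1P[->|xU]; first by rewrite idxw.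
  by rewrite idxU //; have := fresh x xU; rewrite inE negb_or => /andP[].
have -> : U :|: [set x in w :: ws] = (w |: U) :|: [set x in ws].
  by apply/setP => x; rewrite !inE; case: (x == w); rewrite ?orbT.
rewrite idxw in emb2; rewrite card2 cardsU1 wU add1n addSnnS.
by split=> //; exists idx2.
Qed.

Section Families.
Variable Fam : forall n : nat, rel nat -> (nat -> status) -> Prop.
Hypothesis Fam_op1 : forall n r lab x y z, Fam n r lab -> x < n -> y < n -> z < n ->
  r x y -> r y z -> x != z -> ~~ isA (lab x) -> ~~ isA (lab y) -> isA (lab z) ->
  exists r' lab', Fam (n + 3) r' lab' /\ op1_ext n r (isA \o lab) z r' (isA \o lab').
Hypothesis Fam_op2 : forall n r lab x y, Fam n r lab -> x < n -> y < n ->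
  r x y -> ~~ isA (lab x) -> ~~ isA (lab y) ->
  exists r' lab', Fam (n + 4) r' lab' /\ op2_ext n r (isA \o lab) x r' (isA \o lab').

Variable bn : T -> T.
Hypotheses (bnB : forall v, bn v \in B) (ebn : forall v, e v (bn v))
  (bnE : forall v w, w \in B -> e v w -> w = bn v).

(** Closure under [bn] provides, at every vertex of [U], the path or edge that an operation needs
    for its attachment. *)
Definition realized (U : {set T}) :=
  (forall x, x \in U -> bn x \in U) /\
  exists r lab idx, Fam #|U| r lab /\ embedded U idx r (isA \o lab) #|U|.

Let child x y : e x y -> par x != y -> par y = x.
Proof. by move=> exy pxy; have [] := child_par symE irrE root exy pxy. Qed.

(** An edge [uv] leaving [U] has [v] outside [B], since [U] is closed under [bn]. If [u] is in [B],
    the second operation at the edge from [u] to [bn u] adds [v], a neighbour [a] of [v] outside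
    [B], and the matched pair at [a]. Otherwise the first operation adds [v] and the matched pair at
    [v]. *)
Lemma realized_grow (U : {set T}) : realized U -> r0 \in U -> U != setT ->
  exists2 U' : {set T}, realized U' & (U \subset U') && (#|U| < #|U'|).
Proof.
move=> [bnU [r [lab [idx [FamU emb]]]]] r0U nU.
have [_ _ outB] := codeB; have [upU inj eU rU lU] := emb.
have bn2 x : x \in B -> bn (bn x) = x by move=> xB; apply/esym/bnE; rewrite // symE.
have lt_idx x : x \in U -> idx x < #|U| by case/lU.
have l_idx x : x \in U -> isA (lab (idx x)) = (x \notin B) by case/lU.
have [u [v [uU vU euv]]] := tree_exit tr r0U nU.
have pv : par v = u by apply: child => //; apply: contraNneq vU => <-; apply: upU.
have vB : v \notin B by apply: contra vU => vB; rewrite (bnE vB euv) bnU.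
have memU i : i \in iota #|U| 4 -> forall x, x \in U -> idx x != i.
  rewrite mem_iota => /andP[le_i _] x /lt_idx lt_x.
  by apply: contraTneq lt_x => ->; rewrite -leqNgt.
have [uB|uB] := boolP (u \in B).
  have [a aB eva] := outB v vB.
  have pa : par a = v by apply: child => //; rewrite pv; apply: contraNneq aB => <-.
  have pb : par (bn a) = a by apply: child; rewrite // pa; apply: contraNneq vB => ->.
  have pc : par (bn (bn a)) = bn a by apply: child; rewrite // pb; apply: contraNneq aB => ->.
  have [|||||r' [lab' [Fam' ext]]] := @Fam_op2 _ r lab (idx u) (idx (bn u)) FamU;
    rewrite ?lt_idx ?eU ?l_idx ?negbK ?bnU //.
  have [p [q [s [t [pqst r'E l'E [lp lq] [ls lt]]]]]] := ext; rewrite /= in lp lq ls lt.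
  have emb' : embedded U idx r (isA \o lab') (#|U| + 4).
    by apply: embedded_weaken emb _ l'E _; rewrite ?leq_addr.
  have [||||||[idx' emb2] card2] :=
      @embedded_path _ _ [:: v; a; bn a; bn (bn a)] [:: p; q; s; t] _ _ _ u emb' uU.
  - by rewrite /= euv eva !ebn pv pa pb pc !eqxx.
  - by rewrite /= orbF.
  - by rewrite /= vB aB !bnB lp lq (negPf ls) (negPf lt).
  - by rewrite (perm_uniq pqst) iota_uniq.
  - by rewrite (perm_all _ pqst); apply/allP => i; rewrite mem_iota => /andP[].
  - by move=> x xU; rewrite (perm_mem pqst); apply/negP => /memU/(_ x xU); rewrite eqxx.
  exists (U :|: [set x in [:: v; a; bn a; bn (bn a)]]); last first.
    by rewrite subsetUl card2 -[X in X < _]addn0 ltn_add2l.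
  split; last first.
    exists r', lab', idx'; rewrite card2; split=> //.
    by apply: embedded_weaken emb2 _ _ _ => // i j; rewrite r'E.
  move=> x; rewrite !in_setU => /orP[/bnU->//|]; rewrite !inE.
  case/or4P=> /eqP->; try by rewrite eqxx !orbT.
    by rewrite -(bnE uB) ?uU // symE.
  by rewrite (bn2 (bn a)) // eqxx !orbT.
have pb : par (bn v) = v by apply: child; rewrite // pv; apply: contraNneq uB => ->.
have pc : par (bn (bn v)) = bn v by apply: child; rewrite // pb; apply: contraNneq vB => ->.
have neq : idx (bn (bn u)) != idx u.
  apply/eqP => /inj E; move: (bnB (bn u)); rewrite E ?bnU // (negPf uB) //.
have [|||||||||r' [lab' [Fam' ext]]] :=
  @Fam_op1 _ r lab (idx (bn (bn u))) (idx (bn u)) (idx u) FamU;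
  rewrite ?lt_idx ?eU ?l_idx ?negbK ?bnU // 1?symE //.
have [r'E l'E lp ls lt] := ext; rewrite /= in lp ls lt.
have emb' : embedded U idx r (isA \o lab') (#|U| + 3).
  by apply: embedded_weaken emb _ l'E _; rewrite ?leq_addr.
have [||||||[idx' emb2] card2] :=
    @embedded_path _ _ [:: v; bn v; bn (bn v)] [:: #|U|; #|U|.+1; #|U|.+2] _ _ _ u emb' uU.
- by rewrite /= euv !ebn pv pb pc !eqxx.
- by rewrite /= orbF.
- by rewrite /= vB !bnB lp (negPf ls) (negPf lt).
- exact: (iota_uniq #|U| 3).
- by apply/allP => i; rewrite -[_ \in _]/(i \in iota #|U| 3) mem_iota => /andP[].
- move=> x xU; apply/negP; rewrite -[_ \in _]/(idx x \in iota #|U| 3) mem_iota.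
  by rewrite leqNgt lt_idx.
exists (U :|: [set x in [:: v; bn v; bn (bn v)]]); last first.
  by rewrite subsetUl card2 -[X in X < _]addn0 ltn_add2l.
split; last first.
  exists r', lab', idx'; rewrite card2; split=> //.
  by apply: embedded_weaken emb2 _ _ _ => // i j; rewrite r'E.
move=> x; rewrite !in_setU => /orP[/bnU->//|]; rewrite !inE.
by case/or3P=> /eqP->; rewrite ?(bn2 (bn v)) ?eqxx ?orbT.
Qed.

Lemma realized_full (U : {set T}) : realized U -> r0 \in U -> realized [set: T].
Proof.
have [k] := ubnP (#|T| - #|U|); elim: k U => // k IHk U ltk reU r0U.
have [<-//|nU] := eqVneq U setT.
have [U' reU' /andP[sUU' ltU]] := realized_grow reU r0U nU.
apply: (IHk U') => //; last exact: (subsetP sUU').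
have leU : #|U'| <= #|T| by apply: max_card.
by move: ltk ltU leU; clear; lia.
Qed.

End Families.

End Embedding.

(** Abstraction over the family lets one construction serve both: a labeled [P6] is found in the
    tree and grown until it covers everything. *)
Lemma leafy_code_family (Fam : forall n : nat, rel nat -> (nat -> status) -> Prop) lab6 :
  Fam 6 adjP6 lab6 -> (forall i, i < 6 -> isA (lab6 i) = (i == 2) || (i == 3)) ->
  (forall n r lab x y z, Fam n r lab -> x < n -> y < n -> z < n ->
    r x y -> r y z -> x != z -> ~~ isA (lab x) -> ~~ isA (lab y) -> isA (lab z) ->
    exists r' lab', Fam (n + 3) r' lab' /\ op1_ext n r (isA \o lab) z r' (isA \o lab')) ->
  (forall n r lab x y, Fam n r lab -> x < n -> y < n ->
    r x y -> ~~ isA (lab x) -> ~~ isA (lab y) ->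
    exists r' lab', Fam (n + 4) r' lab' /\ op2_ext n r (isA \o lab) x r' (isA \o lab')) ->
  exists n r lab, Fam n r lab /\
    exists f : T -> 'I_n, bijective f /\ forall u v, e u v = r (f u) (f v).
Proof.
move=> Fam6 lab6E Fam_op1 Fam_op2; have [bn bnP] := code_nbr codeB; have [_ _ outB] := codeB.
have bnB v : bn v \in B by case: (bnP v).
have ebn v : e v (bn v) by case: (bnP v).
have bnE v w : w \in B -> e v w -> w = bn v by case: (bnP v) => _ _; apply.
have bn2 x : x \in B -> bn (bn x) = x by move=> xB; apply/esym/bnE; rewrite // symE.
have [x0 _] : exists x : T, true by case/card_gt0P: (leq_trans (isT : 0 < 6) T_gt5) => x; exists x.
(* The initial path consists of a matched pair [c], [b], an edge [aa'] outside the code that starts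
   next to [b], and the matched pair at [a']. *)
have [||b [a [bX aX eba]]] := @tree_exit T e [set bn x0; bn (bn x0)] (bn x0) tr.
- exact: set21.
- by apply: contraTneq T_gt5 => E; rewrite -cardsT -E cards2; case: (_ != _).
have [bB bnb] : b \in B /\ bn b \in [set bn x0; bn (bn x0)].
  by case/set2P: bX => ->; rewrite ?(bn2 (bn x0)) ?set21 ?set22.
have aB : a \notin B by apply: contra aX => aB; rewrite (bnE b a aB eba).
have [a' a'B eaa'] := outB a aB; set c := bn b.
have [par [dep root]] := tree_rooted tr c; have [par_c _ _ _] := root.
have child x y : e x y -> par x != y -> par y = x.
  by move=> exy pxy; have [] := child_par symE irrE root exy pxy.
have cB : c \in B by apply: bnB.
have ecb : e c b by rewrite symE.
have pb : par b = c.
  by apply: child => //; rewrite par_c; apply: contraTneq ecb => ->; rewrite irrE.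
have pa : par a = b by apply: child; rewrite // pb; apply: contraNneq aB => <-.
have pa' : par a' = a by apply: child; rewrite // pa; apply: contraNneq a'B => <-.
have pb' : par (bn a') = a' by apply: child; rewrite // pa'; apply: contraNneq aB => ->.
have pc' : par (bn (bn a')) = bn a' by apply: child; rewrite // pb'; apply: contraNneq a'B => ->.
(* The path starts as the single vertex [c] without edges; the other five vertices follow by
   [embedded_path]. *)
have emb0 : embedded par [set c] (fun=> 0) (fun _ _ => false) (isA \o lab6) 6.
  split=> //.
  - by move=> x /set1P->; rewrite par_c set11.
  - by move=> x y /set1P-> /set1P->.
  - by move=> x y /set1P-> /set1P->; rewrite irrE.
  - by move=> x /set1P->; rewrite /= lab6E // cB.
have [||||||[idx emb] cardU] := @embedded_path _ _ _ root _ _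
    [:: b; a; a'; bn a'; bn (bn a')] [:: 1; 2; 3; 4; 5] _ _ _ c emb0 (set11 _).
- by rewrite /= ecb eba eaa' !ebn pb pa pa' pb' pc' !eqxx.
- by rewrite /= orbF inE; apply: contraTneq ecb => ->; rewrite irrE.
- by rewrite /= !lab6E // aB a'B !bnB bB.
- by [].
- by [].
- by move=> x.
rewrite cards1 in cardU; set U := _ :|: _ in emb cardU.
have cU : c \in U by rewrite setU11.
have reU : realized par Fam bn U.
  split; last first.
    exists adjP6, lab6, idx; rewrite cardU; split=> //.
    apply: embedded_weaken emb _ _ _ => // i j.
    by case: i => [|[|[|[|[|[|i]]]]]]; case: j => [|[|[|[|[|[|j]]]]]];
      rewrite /adjP6 ?ltnS ?ltn0 ?andbF //.
  move=> x; rewrite !in_setU !inE => /orP[/eqP->|]; first by rewrite (bn2 b) ?eqxx ?orbT.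
  have bna : bn a = b by apply/esym/bnE; rewrite // symE.
  case/orP=> [/eqP->|/or4P[]/eqP->]; rewrite ?bna ?(bn2 (bn a')) // ?eqxx ?orbT //.
have [_ [r [lab [idx' [FamT [_ inj eU _ lU]]]]]] :=
  realized_full root Fam_op1 Fam_op2 bnB ebn bnE reU cU.
rewrite cardsT in FamT lU; exists #|T|, r, lab; split=> //.
have lt_idx x : idx' x < #|T| by case: (lU x); rewrite ?inE.
exists (fun x => Ordinal (lt_idx x)); split=> [|u v]; last by rewrite /= eU ?inE.
apply: inj_card_bij; last by rewrite card_ord.
by move=> x y [] /inj; apply; rewrite inE.
Qed.

End Growth.

Lemma leafy_code_famT (T : finType) (e : rel T) B : is_tree e -> 5 < #|T| ->
  leafy_code e B -> in_famT e.
Proof.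
move=> tr T_gt5 codeB; apply: (leafy_code_family tr T_gt5 codeB famT_P6).
- by case=> [|[|[|[|[|[|]]]]]].
- move=> n r lab x y z FT _ _ ltz _ _ _ _ _ lz.
  have lzA : lab z = SA by move: lz; case: (lab z).
  by do 2!eexists; split; [apply: famT_op1 FT ltz lzA | apply: op1_extP].
- move=> n r lab x y FT ltx _ _ lx _.
  have lxB : lab x = SB \/ lab x = SC by move: lx; case: (lab x); auto.
  by do 2!eexists; split; [apply: famT_op2 FT ltx lxB | apply: famT_op2_ext].
Qed.

Lemma leafy_code_famO (T : finType) (e : rel T) B : is_tree e -> 5 < #|T| ->
  leafy_code e B -> in_famO e.
Proof.
move=> tr T_gt5 codeB; apply: (leafy_code_family tr T_gt5 codeB famO_P6).
- by case=> [|[|[|[|[|[|]]]]]].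
- move=> n r lab x y z FO ltx lty ltz rxy ryz xz lx ly lz; have noC := famO_neq_SC FO.
  have [lxB lyB] : lab x = SB /\ lab y = SB.
    by move: lx ly (noC x) (noC y); case: (lab x); case: (lab y).
  have lzA : lab z = SA by move: lz; case: (lab z).
  do 2!eexists; split; first exact: famO_op1 FO ltx lty ltz rxy ryz xz lxB lyB lzA.
  exact: op1_extP.
- move=> n r lab x y FO ltx lty rxy lx ly; have noC := famO_neq_SC FO.
  have [lxB lyB] : lab x = SB /\ lab y = SB.
    by move: lx ly (noC x) (noC y); case: (lab x); case: (lab y).
  do 2!eexists; split; first exact: famO_op2 FO ltx lty rxy lxB lyB.
  exact: famO_op2_ext.
Qed.

Theorem theorem2 (T : finType) (e : rel T) :
  is_tree e -> 6 <= #|T| ->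
  [<-> sd_gamma_t e = 3; in_famT e; in_famO e; cond4 e].
Proof.
move=> tr T_gt5; have T_gt2 : 2 < #|T| by apply: leq_trans T_gt5.
(* Each implication extracts a code from its premise and derives its conclusion from that code. *)
tfae.
- move=> sd3; have [F sFE cF|B codeB] := class3_leafy_code tr (ltnW T_gt2).
    apply: contraL cF => incF; rewrite -ltnNge -sd3.
    by apply: bigmin_inf; rewrite sFE.
  exact: leafy_code_famT codeB.
- move=> [n [r [lab [/famT_nat_code codeN [f [bij_f eE]]]]]].
  by have [B codeB] := nat_code_leafy bij_f eE codeN; apply: leafy_code_famO codeB.
- move=> [n [r [lab [/famO_nat_code codeN [f [bij_f eE]]]]]].
  by have [B codeB] := nat_code_leafy bij_f eE codeN; apply: code_cond4 codeB.
- by case=> F [/(cond4_F_code tr T_gt5)[codeF _] _]; apply: code_class3 codeF.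
Qed.
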